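(* Let $\mathbb{F}_q$ be a finite field with $q$ elements, let $c_1,c_2\in\mathbb{F}_q$ with $c_1\neq c_2$, and let $A_1=\begin{pmatrix} c_1&0\\0&c_2\end{pmatrix}$. Let $\mathcal{D}_{A_1}(\mathbb{F}_q)=\{X\in M_2(\mathbb{F}_q)\mid XA_1X=A_1XA_1\}$. (1) If exactly one of $c_1,c_2$ is zero, then $\mathcal{D}_{A_1}(\mathbb{F}_q)$ is a 2-dimensional affine variety consisting of two 2-dimensional irreducible components and one 1-dimensional irreducible component. In particular, $|\mathcal{D}_{A_1}(\mathbb{F}_q)|=2q^2$. (2) Assume that $c_1$ and $c_2$ are both nonzero and define $\delta:=c_1^2-c_1c_2+c_2^2$. If $\delta=0$, then $|\mathcal{D}_{A_1}(\mathbb{F}_q)|=2q+2$ and $\mathcal{D}_{A_1}(\mathbb{F}_q)$ is a 1-dimensional affine variety consisting of three isolated points and two 1-dimensional irreducible components. If $\delta\neq 0$, then $|\mathcal{D}_{A_1}(\mathbb{F}_q)|=q+3$ and $\mathcal{D}_{A_1}(\mathbb{F}_q)$ is a 1-dimensional affine variety consisting of four isolated points and one 1-dimensional irreducible component.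
   Context: $M_2(\mathbb{F}_q)$ is the space of $2\times 2$ matrices over $\mathbb{F}_q$. Let $R=\mathbb{F}_q[x_{11},x_{12},x_{21},x_{22}]$ be the polynomial ring. For $A\in M_2(\mathbb{F}_q)$ let $X=(x_{ij})$ be the generic matrix and let $I_A\subseteq R$ be the ideal generated by the four entries of $XAX-AXA$. The cardinality $|\mathcal{D}_A(\mathbb{F}_q)|$ is the number of matrices in $M_2(\mathbb{F}_q)$ satisfying $XAX=AXA$. The geometric statements about $\mathcal{D}_A(\mathbb{F}_q)$ as an affine variety refer to the closed subvariety $V(I_A)$ of affine 4-space over $\mathbb{F}_q$ defined by $I_A$: its irreducible components are the $V(\mathfrak{p})$ for $\mathfrak{p}$ a minimal prime ideal of $R$ over $I_A$; the dimension of $V(\mathfrak{p})$ is the Krull dimension of $R/\mathfrak{p}$; the dimension of the variety is the Krull dimension of $R/I_A$. An isolated point is a component $V(\mathfrak{m})$ with $\mathfrak{m}=\langle x_{ij}-m_{ij}\mid 1\le i,j\le 2\rangle$ for some matrix $(m_{ij})\in M_2(\mathbb{F}_q)$. ''Consisting of'' means that the listed objects are all the irreducible components. *)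

(* Defs.v *)
From HB Require Import structures.
From mathcomp Require Import all_boot all_algebra.
From mathcomp Require Import boolp.
From mathcomp Require Import mpoly.

Set Implicit Arguments.
Unset Strict Implicit.
Unset Printing Implicit Defensive.

Import GRing.Theory.

Local Open Scope ring_scope.

(* Ideals are boolean predicates in [ring_quotient]; since [boolp] makes every
   proposition decidable, quantifying over [prime_idealr R] ranges over all
   prime ideals of [R].  Two ideals are identified when they are [=i]. *)

Section Ideals.
Variable R : comNzRingType.

Definition gen_ideal (J : finType) (g : J -> R) : {pred R} :=
  fun f => `[< exists a : J -> R, f = \sum_j a j * g j >].

Lemma gen_ideal_closed (J : finType) (g : J -> R) :
  1 \notin gen_ideal g -> idealr_closed (gen_ideal g).
Proof.
move=> g1; split=> //.
  by apply/asboolP; exists (fun=> 0); rewrite big1 // => j _; rewrite mul0r.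
move=> a _ _ /asboolP[u ->] /asboolP[v ->]; apply/asboolP.
exists (fun j => a * u j + v j); rewrite mulr_sumr -big_split /=.
by apply: eq_bigr => j _; rewrite mulrDl mulrA.
Qed.

Definition prime_chain (n : nat) (P : 'I_n.+1 -> prime_idealr R) : Prop :=
  forall i j : 'I_n.+1, (i < j)%N ->
    {subset P i <= P j} /\ ~ {subset P j <= P i}.

Definition krull_dim (d : nat) : Prop :=
  (exists P : 'I_d.+1 -> prime_idealr R, prime_chain P) /\
  (forall (n : nat) (P : 'I_n.+1 -> prime_idealr R),
      prime_chain P -> (n <= d)%N).

Definition minimal_prime (I : idealr R) (p : prime_idealr R) : Prop :=
  {subset I <= p} /\
  (forall p' : prime_idealr R,
      {subset I <= p'} -> {subset p' <= p} -> p' =i p).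

(* The [V (P k)], for [k < n], are pairwise distinct and are all the
   irreducible components of [V I]. *)
Definition components (I : idealr R) (n : nat)
    (P : 'I_n -> prime_idealr R) : Prop :=
  [/\ forall k, minimal_prime I (P k),
      forall k l, P k =i P l -> k = l
    & forall p, minimal_prime I p -> exists k, p =i P k].

End Ideals.

(* Dimension of the closed subvariety [V I]. *)
Definition variety_dim (R : comNzRingType) (I : idealr R) (d : nat) : Prop :=
  krull_dim {ideal_quot I} d.

Section MatrixVariety.
Variable F : finFieldType.

Local Notation R := {mpoly F[4]}.

Definition generic_mx : 'M[R]_2 :=
  \matrix_(i < 2, j < 2) 'X_(mxvec_index i j : 'I_4).

Definition const_mpoly_mx (A : 'M[F]_2) : 'M[R]_2 := map_mx (@mpolyC 4 F) A.

Definition D_equations (A : 'M[F]_2) : 'M[R]_2 :=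
  let X := generic_mx in let A' := const_mpoly_mx A in
  X *m A' *m X - A' *m X *m A'.

Definition D_ideal (A : 'M[F]_2) : {pred R} :=
  gen_ideal (fun ij : 'I_2 * 'I_2 => D_equations A ij.1 ij.2).

Lemma D_ideal_closed (A : 'M[F]_2) : idealr_closed (D_ideal A).
Proof.
apply: gen_ideal_closed; apply/asboolP => -[a] /(congr1 (meval (fun=> 0))).
rewrite meval1 raddf_sum big1 => [/eqP|[i j] _] /=; first by rewrite oner_eq0.
have D0 : map_mx (meval (fun=> 0)) (D_equations A) = 0.
  have X0 : map_mx (meval (fun=> 0)) generic_mx = 0 :> 'M[F]_2.
    by apply/matrixP=> k l; rewrite !mxE mevalXU.
  by rewrite map_mxB !map_mxM X0 mulmx0 mulmx0 mul0mx subr0.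
by move/matrixP/(_ i j): D0; rewrite !mxE mevalM => ->; rewrite mulr0.
Qed.

HB.instance Definition _ (A : 'M[F]_2) :=
  isIdealr.Build R (D_ideal A) (D_ideal_closed A).

Definition D_points (A : 'M[F]_2) : {set 'M[F]_2} :=
  [set X | X *m A *m X == A *m X *m A].

Definition point_ideal (M : 'M[F]_2) : {pred R} :=
  gen_ideal (fun ij : 'I_2 * 'I_2 =>
    (generic_mx - const_mpoly_mx M) ij.1 ij.2).

Definition is_point (p : prime_idealr R) : Prop :=
  exists M : 'M[F]_2, p =i point_ideal M.

Definition diag2 (c1 c2 : F) : 'M[F]_2 := diag_mx (\row_j [:: c1; c2]`_j).

End MatrixVariety.

(* Main.v *)
(* With X = [x y; z w] and A = diag(a, b), the equation XAX = AXA reads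
     a x^2 + b yz = a^2 x,   y L = z L = 0,   a yz + b w^2 = b^2 w,
   where L = a x + b w - a b.  A prime ideal containing I_A contains L, or else
   it contains y and z, hence x or x - a, and w or w - b.  When a, b <> 0 and L
   vanishes, the other two equations force x = b^2 / (b - a),
   w = a^2 / (a - b) and yz = - a b delta / (a - b)^2: a hyperbola if
   delta <> 0, two crossing lines through the point (a, 0, 0, b) otherwise.
   So every prime over I_A contains one of finitely many explicit primes.  Each
   of these is the kernel of a rational parametrization of its component by
   affine n-space that has a left inverse polynomial on the component, which
   transports chains of primes to F[t_1, ..., t_n].  There chains have length
   at most n, because successive witnesses of strict inclusion are
   algebraically independent over F, whereas any n + 1 polynomials in n
   variables are algebraically dependent. *)

Require Import Defs.
From HB Require Import structures.
From mathcomp Require Import all_boot all_algebra.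
From mathcomp Require Import boolp.
From mathcomp Require Import mpoly.
From mathcomp Require Import ring zify.

Set Implicit Arguments.
Unset Strict Implicit.
Unset Printing Implicit Defensive.

Import GRing.Theory.

Local Open Scope ring_scope.

(** * Chains of primes over an ideal *)

Section IdealTransport.
Variable R : comNzRingType.

Definition prime_of (S : {pred R}) (clS : idealr_closed S)
    (prS : prime_idealr_closed S) : prime_idealr R :=
  HB.pack S (isIdealr.Build R S clS) (isPrimeIdealrClosed.Build R S prS).

Lemma prime_idealrX (P : prime_idealr R) x i : x \notin P -> x ^+ i \notin P.
Proof.
move=> xP; elim: i => [|i IH]; first by rewrite expr0 idealr1.
by rewrite exprS prime_idealrM negb_or xP.
Qed.

End IdealTransport.

Section Contraction.
Variables (A R : comNzRingType) (f : {rmorphism A -> R}) (P : prime_idealr R).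

Lemma contract_closed : idealr_closed [pred x | f x \in P].
Proof.
split; rewrite ?inE ?rmorph0 ?rmorph1 ?idealr0 ?idealr1 // => a u v.
by rewrite !inE rmorphD rmorphM => uP vP; rewrite rpredD // idealMr.
Qed.

Lemma contract_prime : prime_idealr_closed [pred x | f x \in P].
Proof. by move=> u v; rewrite !inE rmorphM prime_idealrM. Qed.

Definition contract : prime_idealr A := prime_of contract_closed contract_prime.

Lemma contractE x : (x \in contract) = (f x \in P).
Proof. by []. Qed.

End Contraction.

Section Chains.
Variable R : comNzRingType.

(** Chains of primes of [R] over [I] replace chains in the quotient by [I], so that they can be
    moved along morphisms without a quotient type. The dimension splits into existence of a chain
    and a bound on all chains. *)
Definition chain_above (I : {pred R}) (d : nat) : Prop :=
  exists P : 'I_d.+1 -> prime_idealr R,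
    prime_chain P /\ forall i, {subset I <= P i}.

Definition chains_above_le (I : {pred R}) (d : nat) : Prop :=
  forall n (P : 'I_n.+1 -> prime_idealr R),
    prime_chain P -> (forall i, {subset I <= P i}) -> (n <= d)%N.

Lemma chain_above0 (I : {pred R}) (p : prime_idealr R) :
  {subset I <= p} -> chain_above I 0.
Proof. by move=> Ip; exists (fun=> p); split=> // -[[] // ?] [[] // ?]. Qed.

Lemma chain_aboveS (I : {pred R}) (p p' : prime_idealr R) x d :
  {subset I <= p} -> {subset p <= p'} -> x \in p' -> x \notin p ->
  chain_above p' d -> chain_above I d.+1.
Proof.
move=> Ip pp' xp' xp [P [chP p'P]].
(* The old chain is shifted up by one index and [p] is put at the bottom; [inord] only retypes
   [i.-1]. *)
exists (fun i => if i == 0 :> nat then p else P (inord i.-1)).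
split; last first.
  by move=> i y /Ip yp; case: ifP => // _; apply/p'P/pp'.
move=> i j ij; rewrite (gtn_eqF (leq_ltn_trans (leq0n i) ij)).
case: ifP => i0; last first.
  by apply: chP; rewrite !inordK; move: i0 (ltn_ord i) (ltn_ord j); lia.
split=> [y /pp'/p'P//|/(_ x)/(_ (p'P _ _ xp'))].
by apply/negP.
Qed.

End Chains.

Section QuotientDimension.
Variables (R : comNzRingType) (I : idealr R).
Local Notation Q := {ideal_quot I}.
Local Notation pi := (\pi_Q%qT : R -> Q).

(** [x] and the chosen representative of its class differ by an element of [I]. So testing [repr]
    for membership in [P] defines the image of [P] in the quotient. *)
Lemma mem_repr_pi (P : prime_idealr R) (IP : {subset I <= P}) x :
  (repr (pi x) \in P) = (x \in P).
Proof.
have /IP xP : x - repr (pi x) \in I by rewrite Quotient.idealrBE reprK.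
by rewrite -[x in RHS](subrK (repr (pi x))) rpredDl.
Qed.

Lemma expand_closed (P : prime_idealr R) (IP : {subset I <= P}) :
  idealr_closed [pred x : Q | repr x \in P].
Proof.
split; rewrite ?inE.
- by rewrite -[0](rmorph0 pi) mem_repr_pi // idealr0.
- by rewrite -[1](rmorph1 pi) mem_repr_pi // idealr1.
move=> a u v; rewrite !inE => uP vP.
rewrite -[a]reprK -[u]reprK -[v]reprK -rmorphM -rmorphD mem_repr_pi //.
by rewrite rpredD // idealMr.
Qed.

Lemma expand_prime (P : prime_idealr R) (IP : {subset I <= P}) :
  prime_idealr_closed [pred x : Q | repr x \in P].
Proof.
move=> u v; rewrite !inE -{1}[u]reprK -{1}[v]reprK -rmorphM mem_repr_pi //.
by rewrite prime_idealrM.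
Qed.

Definition expand (P : prime_idealr R) (IP : {subset I <= P}) :
    prime_idealr Q :=
  prime_of (expand_closed IP) (expand_prime IP).

Lemma expandE (P : prime_idealr R) (IP : {subset I <= P}) x :
  (pi x \in expand IP) = (x \in P).
Proof. exact: mem_repr_pi. Qed.

(** Expansion sends a chain over [I] to the quotient and contraction brings one back. Both preserve
    strict inclusions because [pi] is surjective. *)
Lemma variety_dim_above d :
  chain_above I d -> chains_above_le I d -> variety_dim I d.
Proof.
move=> [P [chP IP]] ub; split.
  exists (fun i => expand (IP i)) => i j /chP[sPij nPij]; split.
    by move=> x; rewrite -[x]reprK !expandE; apply: sPij.
  move=> sPji; apply: nPij => x.
  by rewrite -(expandE (IP j)) => /sPji; rewrite expandE.
move=> n K chK; pose K' i := contract (\pi_Q%qT : {rmorphism R -> Q}) (K i).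
apply: (ub n K') => [i j /chK[sKij nKij]|i x xI].
  split=> [x|sKji]; first by rewrite !contractE; apply: sKij.
  by apply: nKij => x; rewrite -[x]reprK => /sKji.
have pix : pi x = 0.
  by apply/eqP; rewrite -[0](rmorph0 pi) -Quotient.idealrBE subr0.
by rewrite contractE -[X in X \in _]/(pi x) pix idealr0.
Qed.
End QuotientDimension.

(** * Krull dimension of polynomial rings *)

(** Exponent vectors of length [k] with entries below [N], built recursively so that induction on
    [k] peels off the last variable. *)
Fixpoint box (N k : nat) : finType :=
  if k is k'.+1 then ('I_N * box N k')%type else unit.

Lemma card_box N k : #|box N k| = (N ^ k)%N.
Proof.
by elim: k => [|k IH] /=; rewrite ?card_unit // card_prod card_ord IH expnS.
Qed.

Section BoxMonomial.
Variables (R : comNzRingType) (x : nat -> R) (N : nat).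

Fixpoint box_monomial k : box N k -> R :=
  if k is k'.+1 then fun e => x k' ^+ e.1 * box_monomial e.2 else fun=> 1.

Variables (F : fieldType) (iota : {rmorphism F -> R}).

Lemma const_prime_idealr (P : prime_idealr R) a : (iota a \in P) = (a == 0).
Proof.
have [->|a0] := eqVneq a 0; first by rewrite rmorph0 idealr0.
apply/negP => aP; have: 1 \in P; last by rewrite idealr1.
by rewrite -(rmorph1 iota) -(mulVf a0) rmorphM idealMr.
Qed.

(* In a vanishing combination the lowest power of [x k] divides out modulo
   [Q k.+1], and [x k] itself dies in [Q k], so the coefficient of that lowest
   power, a combination of fewer variables, lies in [Q k]. *)
Lemma chain_alg_free (Q : nat -> prime_idealr R) k :
  (forall j, (j < k)%N ->
     [/\ {subset Q j.+1 <= Q j}, x j \in Q j & x j \notin Q j.+1]) ->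
  forall c : box N k -> F,
  \sum_e iota (c e) * box_monomial e \in Q k -> forall e, c e = 0.
Proof.
elim: k => [|k IH] chQ c.
  rewrite (big_pred1 tt) => [|[]//] /=; rewrite mulr1 const_prime_idealr.
  by move/eqP=> c0 [].
have [sQ xQ xnQ] := chQ k (ltnSn k).
have {}IH := IH (fun j jk => chQ j (ltnW jk)).
pose s i := \sum_e iota (c (i, e)) * box_monomial e.
have -> : \sum_e iota (c e) * box_monomial e = \sum_(i < N) x k ^+ i * s i.
  under [RHS]eq_bigr do rewrite mulr_sumr.
  rewrite pair_bigA; apply: eq_bigr => -[i e] _ /=; exact: mulrCA.
move=> sumQ.
suff c0 (m : nat) (i : 'I_N) : (i <= m)%N -> forall e, c (i, e) = 0.
  by case=> i e; apply: (c0 i).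
elim/ltn_ind: m i => m IHm i im; apply: IH.
rewrite -/(s i).
have low0 (j : 'I_N) : (j < i)%N -> s j = 0.
  move=> ji; rewrite /s big1 // => e _.
  by rewrite (IHm j _ j (leqnn j)) ?rmorph0 ?mul0r // (leq_trans ji).
(* With the lower coefficients zero, the whole sum is [x k ^+ i * (s i + x k * t)]. *)
pose t := \sum_(j < N | (i < j)%N) x k ^+ (j - i.+1) * s j.
have /sQ : s i + x k * t \in Q k.+1.
  rewrite (bigID (fun j : 'I_N => (j <= i)%N)) /= in sumQ.
  rewrite (bigD1 i) //= [X in _ + X + _]big1 ?addr0 in sumQ; last first.
    by move=> j /andP[ji jni]; rewrite low0 ?mulr0 // ltn_neqAle jni.
  rewrite (_ : _ + _ = x k ^+ i * (s i + x k * t)) in sumQ.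
    by move: sumQ; rewrite prime_idealrM (negPf (prime_idealrX _ xnQ)).
  rewrite mulrDr mulrA -exprSr; congr (_ + _); rewrite [RHS]mulr_sumr.
  apply: eq_big => [j|j]; first by rewrite -ltnNge.
  by rewrite -ltnNge => ij; rewrite mulrA -exprD subnKC.
by rewrite rpredDr // mulrC idealMr.
Qed.

End BoxMonomial.

Section PolynomialDimension.
Variables (F : fieldType) (n : nat).
Local Notation R := {mpoly F[n]}.

(** A monomial of degree below [b] has [n] exponents, each below [b]. *)
Lemma card_bmultinom_le b : (#|{: 'X_{1..n < b}}| <= b ^ n)%N.
Proof.
rewrite cardT enumT unlock /= /bmnm_enum size_pmap.
apply: leq_trans (count_size _ _) _.
by rewrite size_map -cardE card_tuple card_ord.
Qed.

(** Only linear growth in the exponent matters for the later count, so the bound is crude. *)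
Lemma msizeX_le (p : R) i : ((msize (p ^+ i)).+1 <= i * (msize p).+1 + 2)%N.
Proof.
elim: i => [|i IH]; first by rewrite expr0 msize1.
by rewrite exprS; have := msizeM_le p (p ^+ i); lia.
Qed.

Lemma msize_box_monomial (x : nat -> R) N D k (e : box N k) :
  (forall j, (j < k)%N -> (msize (x j) < D)%N) ->
  (msize (box_monomial x e) <= k * (N * D + 2) + 1)%N.
Proof.
elim: k e => [|k IH] e xD /=; first by rewrite msize1.
have := msizeM_le (x k ^+ e.1) (box_monomial x e.2).
have := IH e.2 (fun j jk => xD j (ltnW jk)).
have := msizeX_le (x k) e.1.
have : (e.1 * (msize (x k)).+1 <= N * D)%N by rewrite leq_mul ?xD // ltnW.
rewrite mulSn; move: (_ * (msize _).+1)%N (N * D)%N (k * _)%N => a b c.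
move: (msize (_ * _)) (msize (_ ^+ _)) (msize (box_monomial _ _)) => p q r.
lia.
Qed.

(* There are [N ^ n.+1] box monomials in the [x j], of degree [O(N)], hence in
   a space of dimension [O(N ^ n)]. *)
Lemma alg_dependent (x : nat -> R) :
  exists N (c : box N n.+1 -> F),
    \sum_e (c e)%:MP * box_monomial x e = 0 /\ exists e, c e != 0.
Proof.
pose D := (\max_(j < n.+1) msize (x j)).+1.
have xD j : (j < n.+1)%N -> (msize (x j) < D)%N.
  by move=> jn; rewrite ltnS (leq_bigmax (Ordinal jn)).
(* [C] is chosen so that every box monomial has size at most [N * C]. Since [N] exceeds [C ^ n], the
   [N ^ n.+1] box monomials outnumber the at most [b ^ n = N ^ n * C ^ n] monomials of degree below
   [b]. *)
pose C := (n.+1 * (D + 2) + 2)%N; pose N := (C ^ n).+1; pose b := (N * C)%N.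
have msize_b (e : box N n.+1) : (msize (box_monomial x e) <= b)%N.
  apply: leq_trans (msize_box_monomial e xD) _.
  by rewrite /b /C /N; lia.
(* Row [i] lists the coefficients of one box monomial. With more rows than columns, [M] has a
   nonzero left kernel vector, which is the dependence relation. *)
pose M := \matrix_(i < #|box N n.+1|, j < #|{: 'X_{1..n < b}}|)
  (box_monomial x (enum_val i))@_(enum_val j).
have ltM : (#|{: 'X_{1..n < b}}| < #|box N n.+1|)%N.
  apply: leq_ltn_trans (card_bmultinom_le b) _.
  by rewrite card_box expnMn expnS mulnC ltn_pmul2r ?expn_gt0.
have : kermx M != 0.
  rewrite kermx_eq0 -row_leq_rank -ltnNge.
  exact: leq_ltn_trans (rank_leq_col M) ltM.
case/rowV0Pn=> v /sub_kermxP vM v0.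
exists N, (fun e => v 0 (enum_rank e)); split; last first.
  have [i vi] : exists i, v 0 i != 0 by apply/rV0Pn.
  by exists (enum_val i); rewrite enum_valK.
apply/mpolyP => m; rewrite mcoeff0 raddf_sum /=.
under eq_bigr do rewrite mul_mpolyC mcoeffZ.
have [mb|bm] := ltnP (mdeg m) b; last first.
  rewrite big1 // => e _; rewrite memN_msupp_eq0 ?mulr0 //.
  apply/negP => /msize_mdeg_lt lt_m.
  by have := leq_trans lt_m (msize_b e); rewrite ltnNge bm.
have /matrixP/(_ 0 (enum_rank (BMultinom mb))) := vM.
rewrite !mxE => vMm; rewrite -[RHS]vMm (reindex enum_rank) /=; last first.
  by apply: onW_bij; apply: enum_rank_bij.
by apply: eq_bigr => e _; rewrite mxE !enum_rankK.
Qed.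

Lemma mpoly_chain_le m (P : 'I_m.+1 -> prime_idealr R) :
  prime_chain P -> (m <= n)%N.
Proof.
move=> chP; rewrite leqNgt; apply/negP => nm.
(* [chain_alg_free] numbers its primes downwards, so the first [n + 2] primes of the chain are
   reversed; [Q n.+1] is [P 0]. *)
pose Q j := P (inord (n.+1 - j)).
have lt_inord j : (j < n.+1)%N ->
    ((inord (n.+1 - j.+1) : 'I_m.+1) < (inord (n.+1 - j) : 'I_m.+1))%N.
  by move=> jn; rewrite !inordK; lia.
have [x xP] : {x : nat -> R & forall j, (j < n.+1)%N ->
    x j \in Q j /\ x j \notin Q j.+1}.
  apply: (@boolp.choice _ _
    (fun j y => (j < n.+1)%N -> y \in Q j /\ y \notin Q j.+1)) => j.
  have [jn|//] := ltnP j n.+1; last by exists 0.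
  have [_ /existsNP[y yP]] := chP _ _ (lt_inord j jn).
  by move/not_implyP: yP => [yQ /negP ynQ]; exists y.
have [N [c [sum0 [e /eqP[]]]]] := alg_dependent x.
apply: (@chain_alg_free _ x N F (@mpolyC n F) Q n.+1) e => [j jn|].
  have [xQ xnQ] := xP j jn; split=> //.
  by have [] := chP _ _ (lt_inord j jn).
by rewrite sum0 idealr0.
Qed.

End PolynomialDimension.

(** * Parametrized varieties *)

Section Kernel.
Variables (A : comNzRingType) (B : idomainType) (f : {rmorphism A -> B}).

Lemma ker_idealr_closed : idealr_closed [pred x | f x == 0].
Proof.
split; rewrite ?inE ?rmorph0 ?rmorph1 ?oner_eq0 // => a x y.
by rewrite !inE rmorphD rmorphM => /eqP-> /eqP->; rewrite mulr0 addr0.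
Qed.

Lemma ker_prime_closed : prime_idealr_closed [pred x | f x == 0].
Proof. by move=> x y; rewrite !inE rmorphM mulf_eq0. Qed.

Definition ker_ideal : prime_idealr A :=
  prime_of ker_idealr_closed ker_prime_closed.

Lemma ker_idealE x : (x \in ker_ideal) = (f x == 0).
Proof. by []. Qed.

End Kernel.

Section Covers.
Variable R : comNzRingType.

(** A prime over [I] inside [P k] contains some [P l]; then [P l] lies in [P k], so [l = k] and the
    two primes agree. This gives minimality, and the covering hypothesis gives completeness. *)
Lemma components_cover (I : idealr R) n (P : 'I_n -> prime_idealr R) :
  (forall k, {subset I <= P k}) ->
  (forall k l, {subset P k <= P l} -> k = l) ->
  (forall Q : prime_idealr R, {subset I <= Q} -> exists k, {subset P k <= Q}) ->
  components I P.
Proof.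
move=> IP Pinj cover; split.
- move=> k; split=> // p' Ip' p'P; have [l Pl] := cover p' Ip'.
  have lk : l = k by apply: Pinj => x /Pl/p'P.
  by move=> x; apply/idP/idP => [/p'P//|]; rewrite -lk => /Pl.
- by move=> k l kl; apply: Pinj => x; rewrite kl.
- move=> p [Ip minp]; have [k Pk] := cover p Ip; exists k => x.
  by rewrite (minp _ (IP k) Pk).
Qed.

(** The bottom prime of a chain over [I] contains some [P k], and hence so does the whole chain. *)
Lemma chains_above_le_cover (I : {pred R}) (J : Type)
    (P : J -> prime_idealr R) d :
  (forall Q : prime_idealr R, {subset I <= Q} -> exists k, {subset P k <= Q}) ->
  (forall k, chains_above_le (P k) d) -> chains_above_le I d.
Proof.
move=> cover leP n Q chQ IQ; have [k Pk] := cover (Q ord0) (IQ ord0).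
apply: (leP k n Q chQ) => i x /Pk xQ.
have [i0|] := posnP i; first by rewrite (_ : i = ord0) //; apply: val_inj.
by move=> /(chQ ord0 i)[+ _]; apply.
Qed.

End Covers.

Section Parametrization.
Variables (F : fieldType) (m n : nat).
Local Notation R := {mpoly F[m]}.
Local Notation S := {mpoly F[n]}.

Definition poly_eval (k l : nat) (t : 'I_k -> {mpoly F[l]}) :
  {mpoly F[k]} -> {mpoly F[l]} := mmap (@mpolyC l F) t.
HB.instance Definition _ k l t :=
  GRing.RMorphism.on (@poly_eval k l t).

(** The values lie in a field, so the kernel of this evaluation is prime. *)
Definition frac_eval (s : S) (g : 'I_m -> S) : R -> {fraction S} :=
  mmap (@tofrac S \o @mpolyC n F) (fun i => tofrac (g i) / tofrac s).
HB.instance Definition _ s g := GRing.RMorphism.on (frac_eval s g).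

(* The map [x_i |-> num i / den] from affine [n]-space to affine [m]-space,
   with a left inverse [sec] that is polynomial on its image; [den_inv]
   represents [1 / den] on the image. *)
Record parametrization := Parametrization {
  den : S;
  num : 'I_m -> S;
  sec : 'I_n -> R;
  den_inv : R;
  den_neq0 : den != 0;
  secK : forall i, frac_eval den num (sec i) = tofrac 'X_i;
  den_invK : frac_eval den num den_inv = (tofrac den)^-1 }.

Variable p : parametrization.
Local Notation psi := (poly_eval (sec p)).
Local Notation phi := (frac_eval (den p) (num p)).

Definition param_ideal : prime_idealr R := ker_ideal phi.

(** Modulo [I], the coordinates are given by the parametrization evaluated at the section, and the
    denominator is invertible. By [param_satisfied] and [param_ideal_min], [param_ideal] is the
    least ideal with this property. *)
Definition satisfied (I : {pred R}) : Prop :=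
  (forall i, psi (den p) * 'X_i - psi (num p i) \in I) /\
  psi (den p) * den_inv p - 1 \in I.

Lemma frac_evalX i : phi 'X_i = tofrac (num p i) / tofrac (den p).
Proof. by rewrite /frac_eval mmapX mmap1U. Qed.

(** Up to a power of the denominator, [f] is the image under [psi] of its own cleared numerator [g],
    modulo every satisfied ideal at once. The property holds for constants and variables and passes
    to sums and products. *)
Lemma clear_denominators (f : R) : exists N g,
  phi f * tofrac (den p) ^+ N = tofrac g /\
  forall I : idealr R, satisfied I -> psi (den p) ^+ N * f - psi g \in I.
Proof.
set d := tofrac (den p); set d' := psi (den p).
have d0 : d != 0 by rewrite tofrac_eq0 den_neq0.
pose ok f := exists N g, phi f * d ^+ N = tofrac g /\
  forall I : idealr R, satisfied I -> d' ^+ N * f - psi g \in I.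
have okD f1 f2 : ok f1 -> ok f2 -> ok (f1 + f2).
  move=> [N1 [g1 [e1 h1]]] [N2 [g2 [e2 h2]]].
  exists (N1 + N2)%N, (den p ^+ N2 * g1 + den p ^+ N1 * g2); split.
    by rewrite !rmorphD !rmorphM !rmorphXn /= -e1 -e2 exprD; ring.
  move=> I sI; rewrite rmorphD !rmorphM !rmorphXn /= -/d'.
  have -> : d' ^+ (N1 + N2) * (f1 + f2)
            - (d' ^+ N2 * psi g1 + d' ^+ N1 * psi g2)
     = d' ^+ N2 * (d' ^+ N1 * f1 - psi g1)
       + d' ^+ N1 * (d' ^+ N2 * f2 - psi g2).
    by rewrite exprD; ring.
  by rewrite rpredD // idealMr ?h1 ?h2.
have okM f1 f2 : ok f1 -> ok f2 -> ok (f1 * f2).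
  move=> [N1 [g1 [e1 h1]]] [N2 [g2 [e2 h2]]].
  exists (N1 + N2)%N, (g1 * g2); split.
    by rewrite !rmorphM /= -e1 -e2 exprD; ring.
  move=> I sI; rewrite rmorphM.
  have -> : d' ^+ (N1 + N2) * (f1 * f2) - psi g1 * psi g2
     = d' ^+ N2 * f2 * (d' ^+ N1 * f1 - psi g1)
       + psi g1 * (d' ^+ N2 * f2 - psi g2).
    by rewrite exprD; ring.
  by rewrite rpredD // idealMr ?h1 ?h2.
have okC c : ok c%:MP.
  exists 0%N, c%:MP; split; first by rewrite mulr1 /frac_eval mmapC.
  by move=> I _; rewrite mul1r /poly_eval mmapC subrr idealr0.
have okX i : ok 'X_i.
  exists 1%N, (num p i); split; last by move=> I [sI _]; rewrite expr1.
  by rewrite expr1 frac_evalX divfK.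
change (ok f); elim/mpolyind: f => [|c mm f _ _ okf]; first by rewrite -mpolyC0.
apply: okD => //; rewrite -mul_mpolyC; apply: (okM) => //.
rewrite mpolyXE_id.
apply: (big_ind ok) => [|f1 f2|i _]; [by rewrite -mpolyC1|exact: (okM)|].
by elim: (mm i) => [|j IH]; rewrite ?expr0 -?mpolyC1 // exprS; apply: (okM).
Qed.

Lemma frac_eval_sec g : phi (psi g) = tofrac g.
Proof.
elim/mpolyind: g => [|c mm g _ _ IH]; first by rewrite !rmorph0.
rewrite !rmorphD /= IH; congr (_ + _); rewrite -mul_mpolyC !rmorphM /=.
congr (_ * _); first by rewrite /poly_eval mmapC /frac_eval mmapC.
rewrite mpolyXE_id !rmorph_prod; apply: eq_bigr => i _.
rewrite !rmorphXn /=; congr (_ ^+ _).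
by rewrite /poly_eval mmapX mmap1U secK.
Qed.

Lemma param_satisfied : satisfied param_ideal.
Proof.
have d0 : tofrac (den p) != 0 by rewrite tofrac_eq0 den_neq0.
split=> [i|]; rewrite ker_idealE rmorphB rmorphM /= !frac_eval_sec.
  by rewrite frac_evalX mulrC divfK ?subrr.
by rewrite den_invK divff ?rmorph1 ?subrr.
Qed.

(** If [phi] kills [f], its cleared numerator is zero, so a power of the denominator times [f] lies
    in [I]; that power is invertible modulo [I]. *)
Lemma param_ideal_min (I : idealr R) :
  satisfied I -> {subset param_ideal <= I}.
Proof.
move=> sI f; rewrite ker_idealE => /eqP phif.
have [N [g [e /(_ I sI)]]] := clear_denominators f.
move: e; rewrite phif mul0r => /esym/eqP; rewrite tofrac_eq0 => /eqP->.
rewrite rmorph0 subr0 => dfI.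
have [_ duI] := sI.
have -> : f = den_inv p ^+ N * (psi (den p) ^+ N * f)
            - f * ((psi (den p) * den_inv p) ^+ N - 1) by rewrite exprMn; ring.
by apply: rpredB; apply: idealMr => //; rewrite subrX1 mulrC idealMr.
Qed.

(** Contraction along [psi] keeps the chain strict: modulo [param_ideal] every [f] comes from [psi]
    up to a power of the denominator, which no prime of the chain contains. Then [mpoly_chain_le]
    applies. *)
Lemma param_chains_le : chains_above_le param_ideal n.
Proof.
move=> k P chP leP; have [_ duI] := param_satisfied.
have dP i : psi (den p) \notin P i.
  apply/negP => dPi; have := leP i _ duI.
  by rewrite rpredBl ?idealr1 // mulrC idealMr.
apply: (@mpoly_chain_le F n k (fun i => contract psi (P i))) => i j ij.
have [sPij nPji] := chP i j ij; split=> [x|].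
  by rewrite !contractE; apply: sPij.
move=> sub; apply: nPji => f fP.
have [N [g [_ /(_ param_ideal param_satisfied) dfg]]] := clear_denominators f.
have gP : psi g \in P i.
  apply: (sub g); rewrite contractE.
  by have := leP j _ dfg; rewrite rpredBl // idealMr.
have := leP i _ dfg; rewrite rpredBr //.
by rewrite prime_idealrM (negPf (prime_idealrX _ (dP i))).
Qed.

End Parametrization.

(** * Coordinate slices *)

(* A slice of affine [m]-space: [C i = Some c] imposes [x_i = c], and
   [C i = None] leaves [x_i] free. *)
Section Slices.
Variables (F : fieldType) (m : nat).
Local Notation R := {mpoly F[m]}.
Implicit Types (C : 'I_m -> option F) (I : idealr R).

Definition free_coords C := [set i | C i == None].
Local Notation dim C := #|free_coords C|.

(** Free coordinates are renumbered by their rank in [free_coords C]. The default [0] is never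
    reached, since each free coordinate has a rank. *)
Definition slice_num C (i : 'I_m) : {mpoly F[dim C]} :=
  if C i is Some c then c%:MP
  else if [pick k : 'I_(dim C) | enum_val k == i] is Some k then 'X_k else 0.

Lemma slice_numX C k : slice_num C (enum_val k) = 'X_k.
Proof.
rewrite /slice_num; have := enum_valP k; rewrite inE => /eqP->.
by case: pickP => [k' /eqP/enum_val_inj->//|/(_ k)]; rewrite eqxx.
Qed.

Lemma slice_secK C k :
  frac_eval 1 (slice_num C) 'X_(enum_val k) = tofrac 'X_k.
Proof.
by rewrite /frac_eval mmapX mmap1U slice_numX tofrac1 divr1.
Qed.

Lemma slice_den_invK C :
  frac_eval 1 (slice_num C) 1 = (tofrac 1)^-1.
Proof. by rewrite tofrac1 rmorph1 invr1. Qed.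

Definition slice C : parametrization F m (dim C) :=
  Parametrization (oner_neq0 _) (@slice_secK C) (slice_den_invK C).

Definition slice_ideal C : prime_idealr R := param_ideal (slice C).

Lemma slice_satisfied C I :
  (forall i c, C i = Some c -> 'X_i - c%:MP \in I) -> satisfied (slice C) I.
Proof.
move=> CI; split=> [i|] /=; rewrite rmorph1 ?mul1r ?subrr ?idealr0 //.
case Ci: (C i) => [c|]; first by rewrite /slice_num Ci /poly_eval mmapC CI.
have iC : i \in free_coords C by rewrite inE Ci.
rewrite -(enum_rankK_in iC iC) slice_numX /poly_eval mmapX mmap1U subrr.
exact: idealr0.
Qed.

Lemma slice_min C I :
  (forall i c, C i = Some c -> 'X_i - c%:MP \in I) ->
  {subset slice_ideal C <= I}.
Proof. by move=> /slice_satisfied/param_ideal_min. Qed.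

(** A fixed coordinate evaluates to its constant and a free one to a variable, which equals no
    constant. These memberships suffice to tell slices apart. *)
Lemma mem_slice C i c : ('X_i - c%:MP \in slice_ideal C) = (C i == Some c).
Proof.
rewrite ker_idealE rmorphB /= {2}/frac_eval mmapC.
rewrite (frac_evalX (slice C)) /= tofrac1 divr1.
rewrite -tofracB tofrac_eq0 subr_eq0.
case Ci: (C i) => [c'|].
  rewrite /slice_num Ci; apply/eqP/eqP=> [|[->]//].
  by move/(congr1 (mcoeff 0)); rewrite !mcoeffC eqxx !mulr1 => ->.
have iC : i \in free_coords C by rewrite inE Ci.
rewrite -(enum_rankK_in iC iC) slice_numX; apply/negP => /eqP.
move/(congr1 (mcoeff U_(enum_rank_in iC i))); rewrite mcoeffX mcoeffC eqxx.
by rewrite mnm1_eq0 mulr0 => /eqP; rewrite oner_eq0.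
Qed.

Lemma slice_chains_le C : chains_above_le (slice_ideal C) (dim C).
Proof. exact: param_chains_le. Qed.

(** The free coordinates are set to [0] one after the other. *)
Lemma slice_chain C : chain_above (slice_ideal C) (dim C).
Proof.
move dC: (dim C) => d; elim: d C dC => [|d IH] C dC.
  exact: (chain_above0 (p := slice_ideal C)).
have /card_gt0P[i] : (0 < dim C)%N by rewrite dC.
rewrite inE => /eqP Ci.
pose C' k := if k == i then Some 0 else C k.
apply: (chain_aboveS (p := slice_ideal C) (p' := slice_ideal C')
                     (x := 'X_i - 0%:MP)) => //.
- apply: slice_min => k c Ck; rewrite mem_slice /C'.
  by move: Ck; have [->|_ ->//] := eqVneq k i; rewrite Ci.
- by rewrite mem_slice /C' eqxx.
- by rewrite mem_slice Ci.
- apply: IH; apply: succn_inj.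
  rewrite -dC (cardsD1 i (free_coords C)) inE Ci eqxx add1n; congr _.+1.
  by apply: eq_card => k; rewrite !inE /C'; case: (k == i).
Qed.

Lemma slice_dim C : variety_dim (slice_ideal C) (dim C).
Proof.
by apply: variety_dim_above; [apply: slice_chain | apply: slice_chains_le].
Qed.

End Slices.

(** * Two by two matrices *)

(* The 2x2 matrix [x y; z w] with [x] in position [(j, j)]. *)
Definition mx_at (T : Type) (j : 'I_2) (x y z w : T) : 'M[T]_2 :=
  \matrix_(k, l) if k == j then if l == j then x else y
                 else if l == j then z else w.

Lemma rev_ord2_neq (j : 'I_2) : (rev_ord j == j) = false.
Proof. by case: j => [[|[|]]]. Qed.

Section MatrixAt.
Variables (T : Type) (j : 'I_2).
Implicit Types x y z w : T.

Lemma mx_atP x y z w x' y' z' w' :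
  mx_at j x y z w = mx_at j x' y' z' w' <->
  [/\ x = x', y = y', z = z' & w = w'].
Proof.
split=> [/matrixP M|[-> -> -> ->]//].
have jN := rev_ord2_neq j.
by split; [have := M j j|have := M j (rev_ord j)|have := M (rev_ord j) j|
  have := M (rev_ord j) (rev_ord j)]; rewrite !mxE ?eqxx ?jN.
Qed.

Lemma mx_at_eta (M : 'M[T]_2) :
  M = mx_at j (M j j) (M j (rev_ord j)) (M (rev_ord j) j)
            (M (rev_ord j) (rev_ord j)).
Proof.
apply/matrixP => k l; rewrite !mxE.
have jE (k' : 'I_2) : k' = if k' == j then j else rev_ord j.
  case: eqP => // /eqP; case: j k' => [[|[|]] // ?] [[|[|]] // ?] _;
  exact: val_inj.
by rewrite [in LHS](jE k) [in LHS](jE l); case: (k == j); case: (l == j).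
Qed.

End MatrixAt.

Lemma map_mx_at (T U : Type) (f : T -> U) j x y z w :
  map_mx f (mx_at j x y z w) = mx_at j (f x) (f y) (f z) (f w).
Proof. by apply/matrixP => k l; rewrite !mxE; do 2 case: eqP. Qed.

Lemma mx_at_equation (T : comNzRingType) j (a b x y z w : T) :
  let X := mx_at j x y z w in let A := mx_at j a 0 0 b in
  X *m A *m X - A *m X *m A =
  mx_at j (a * x ^+ 2 + b * (y * z) - a ^+ 2 * x)
          (y * (a * x + b * w - a * b))
          (z * (a * x + b * w - a * b))
          (a * (y * z) + b * w ^+ 2 - b ^+ 2 * w).
Proof.
apply/matrixP => k l.
rewrite !(mxE, big_ord_recl, big_ord0).
case: j k l => [[|[|]] // ?] [[|[|]] // ?] [[|[|]] // ?];
rewrite /=; ring.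
Qed.

Lemma sum_ord2_at (j : 'I_2) (E : 'I_2 -> nat) :
  (\sum_k E k = E j + E (rev_ord j))%N.
Proof.
rewrite !big_ord_recl big_ord0 addn0.
case: j => [[|[|]] // ?]; last rewrite addnC; congr (E _ + E _)%N;
exact: val_inj.
Qed.

(** * The equations XAX = AXA *)

Section GeneratedIdeals.
Variables (R : comNzRingType) (J : finType) (g : J -> R).

Lemma mem_gen_ideal j : g j \in gen_ideal g.
Proof.
apply/asboolP; exists (fun i => (i == j)%:R).
by rewrite (bigD1 j) //= eqxx mul1r big1 ?addr0 // => i /negPf->; rewrite mul0r.
Qed.

Lemma gen_ideal_sub (I : idealr R) :
  (forall j, g j \in I) -> {subset gen_ideal g <= I}.
Proof.
move=> gI _ /asboolP[a ->]; elim/big_ind: _ => [|u v|j _]; first exact: idealr0.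
  exact: rpredD.
exact: idealMr.
Qed.

End GeneratedIdeals.

Section Variety.
Variables (F : finFieldType) (j : 'I_2).
Local Notation R := {mpoly F[4]}.
Local Notation j' := (rev_ord j).

Definition entry (k l : 'I_2) : R := 'X_(mxvec_index k l : 'I_4).
Local Notation x := (entry j j).
Local Notation y := (entry j j').
Local Notation z := (entry j' j).
Local Notation w := (entry j' j').

Lemma generic_mxE : generic_mx F = mx_at j x y z w.
Proof. by rewrite [LHS](mx_at_eta j) !mxE. Qed.

Definition mx_slice (C : 'M[option F]_2) : prime_idealr R :=
  slice_ideal (fun i : 'I_4 => mxvec C 0 (i : 'I_(2 * 2))).

Definition coord_in (I : {pred R}) (v : R) (o : option F) : Prop :=
  if o is Some c then v - c%:MP \in I else True.

(** The order on coordinate conditions that matches inclusion of slice ideals, with the free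
    coordinate at the bottom. *)
Definition coord_le (o o' : option F) : bool := (o == None) || (o == o').

Implicit Types (ox oy oz ow : option F).

Lemma mx_slice_min ox oy oz ow (I : idealr R) :
  coord_in I x ox -> coord_in I y oy -> coord_in I z oz -> coord_in I w ow ->
  {subset mx_slice (mx_at j ox oy oz ow) <= I}.
Proof.
move=> Ix Iy Iz Iw; apply: slice_min => i c.
case: i / (@mxvec_indexP 2 2 i) => k l; rewrite mxvecE.
rewrite -/(entry k l).
have /matrixP/(_ k l) := generic_mxE; rewrite !mxE -/(entry k l) => ->.
by do 2 case: ifP => _; [move: Ix|move: Iy|move: Iz|move: Iw] => + e;
  rewrite /coord_in e.
Qed.

Lemma mem_mx_slice ox oy oz ow c :
  let P := mx_slice (mx_at j ox oy oz ow) in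
  [/\ (x - c%:MP \in P) = (ox == Some c), (y - c%:MP \in P) = (oy == Some c),
      (z - c%:MP \in P) = (oz == Some c) & (w - c%:MP \in P) = (ow == Some c)].
Proof.
have jN := rev_ord2_neq j.
by rewrite /= /entry !mem_slice !mxvecE !mxE eqxx jN.
Qed.

Lemma sub_mx_slice ox oy oz ow ox' oy' oz' ow' :
  {subset mx_slice (mx_at j ox oy oz ow)
       <= mx_slice (mx_at j ox' oy' oz' ow')} ->
  [&& coord_le ox ox', coord_le oy oy', coord_le oz oz' & coord_le ow ow'].
Proof.
move=> sub; apply/and4P; split.
- case: ox sub => [c|] sub //.
  have [e _ _ _] := mem_mx_slice (Some c) oy oz ow c.
  have [e' _ _ _] := mem_mx_slice ox' oy' oz' ow' c.
  by rewrite /coord_le /= eq_sym -e' sub // e.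
- case: oy sub => [c|] sub //.
  have [_ e _ _] := mem_mx_slice ox (Some c) oz ow c.
  have [_ e' _ _] := mem_mx_slice ox' oy' oz' ow' c.
  by rewrite /coord_le /= eq_sym -e' sub // e.
- case: oz sub => [c|] sub //.
  have [_ _ e _] := mem_mx_slice ox oy (Some c) ow c.
  have [_ _ e' _] := mem_mx_slice ox' oy' oz' ow' c.
  by rewrite /coord_le /= eq_sym -e' sub // e.
- case: ow sub => [c|] sub //.
  have [_ _ _ e] := mem_mx_slice ox oy oz (Some c) c.
  have [_ _ _ e'] := mem_mx_slice ox' oy' oz' ow' c.
  by rewrite /coord_le /= eq_sym -e' sub // e.
Qed.

Lemma mx_slice_free ox oy oz ow d :
  ((ox == None) + (oy == None) + (oz == None) + (ow == None))%N = d ->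
  #|free_coords (fun i : 'I_4 =>
      mxvec (mx_at j ox oy oz ow) 0 (i : 'I_(2 * 2)))| = d.
Proof.
move=> <-; rewrite -sum1_card big_mkcond.
rewrite (reindex _ (curry_mxvec_bij 2 2)) /=.
rewrite (eq_bigr (fun kl =>
    (mx_at j ox oy oz ow kl.1 kl.2 == None : nat))); last first.
  by case=> k l _; rewrite inE mxvecE /=; case: eqP.
rewrite -(pair_bigA _ (fun k l => (mx_at j ox oy oz ow k l == None : nat))) /=.
have jN := rev_ord2_neq j.
by rewrite !(sum_ord2_at j) !mxE !eqxx jN; lia.
Qed.

Lemma mx_slice_dim ox oy oz ow d :
  ((ox == None) + (oy == None) + (oz == None) + (ow == None))%N = d ->
  let P := mx_slice (mx_at j ox oy oz ow) in
  [/\ variety_dim P d, chain_above P d & chains_above_le P d].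
Proof.
move/mx_slice_free=> <-; split.
- exact: slice_dim.
- exact: slice_chain.
- exact: slice_chains_le.
Qed.

(** The generators of the point ideal lie in the slice. Conversely the point ideal is proper and
    contains the conditions of the slice, so [mx_slice_min] applies to it. *)
Lemma point_idealP (c1 c2 c3 c4 : F) :
  is_point (mx_slice (mx_at j (Some c1) (Some c2) (Some c3) (Some c4))).
Proof.
set P := mx_slice _; pose M := mx_at j c1 c2 c3 c4; exists M.
have [e1 _ _ _] := mem_mx_slice (Some c1) (Some c2) (Some c3) (Some c4) c1.
have [_ e2 _ _] := mem_mx_slice (Some c1) (Some c2) (Some c3) (Some c4) c2.
have [_ _ e3 _] := mem_mx_slice (Some c1) (Some c2) (Some c3) (Some c4) c3.
have [_ _ _ e4] := mem_mx_slice (Some c1) (Some c2) (Some c3) (Some c4) c4.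
have genE : generic_mx F - const_mpoly_mx M =
    mx_at j (x - c1%:MP) (y - c2%:MP) (z - c3%:MP) (w - c4%:MP).
  rewrite generic_mxE /const_mpoly_mx map_mx_at.
  by apply/matrixP => k l; rewrite !mxE; do 2 case: eqP.
have subP : {subset point_ideal M <= P}.
  apply: gen_ideal_sub => -[k l] /=; rewrite genE mxE.
  by do 2 case: ifP => _; rewrite ?e1 ?e2 ?e3 ?e4 eqxx.
have clM : idealr_closed (point_ideal M).
  by apply: gen_ideal_closed; apply/negP => /subP; rewrite idealr1.
pose I : idealr R := HB.pack (point_ideal M) (isIdealr.Build R _ clM).
move=> v; apply/idP/idP; last exact: subP.
have jN := rev_ord2_neq j.
have memI k l : (generic_mx F - const_mpoly_mx M) k l \in I.
  exact: (mem_gen_ideal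
    (fun kl => (generic_mx F - const_mpoly_mx M) kl.1 kl.2) (k, l)).
rewrite genE in memI.
apply: (@mx_slice_min _ _ _ _ I).
- by have := memI j j; rewrite mxE eqxx.
- by have := memI j j'; rewrite mxE eqxx jN.
- by have := memI j' j; rewrite mxE eqxx jN.
- by have := memI j' j'; rewrite mxE jN.
Qed.

Section Equations.
Variables a b : F.
Local Notation A := (mx_at j a 0 0 b).

Lemma D_equationsE : D_equations A =
  mx_at j (a%:MP * x ^+ 2 + b%:MP * (y * z) - a%:MP ^+ 2 * x)
          (y * (a%:MP * x + b%:MP * w - a%:MP * b%:MP))
          (z * (a%:MP * x + b%:MP * w - a%:MP * b%:MP))
          (a%:MP * (y * z) + b%:MP * w ^+ 2 - b%:MP ^+ 2 * w).
Proof.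
rewrite /D_equations /const_mpoly_mx map_mx_at generic_mxE mpolyC0.
exact: mx_at_equation.
Qed.

Lemma D_ideal_eqs (I : {pred R}) : {subset D_ideal A <= I} ->
  [/\ a%:MP * x ^+ 2 + b%:MP * (y * z) - a%:MP ^+ 2 * x \in I,
      y * (a%:MP * x + b%:MP * w - a%:MP * b%:MP) \in I,
      z * (a%:MP * x + b%:MP * w - a%:MP * b%:MP) \in I &
      a%:MP * (y * z) + b%:MP * w ^+ 2 - b%:MP ^+ 2 * w \in I].
Proof.
move=> sub; have jN := rev_ord2_neq j.
have memI k l : D_equations A k l \in I.
  by apply/sub/(mem_gen_ideal (fun kl => D_equations A kl.1 kl.2) (k, l)).
rewrite D_equationsE in memI; split.
- by have := memI j j; rewrite mxE eqxx.
- by have := memI j j'; rewrite mxE eqxx jN.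
- by have := memI j' j; rewrite mxE eqxx jN.
- by have := memI j' j'; rewrite mxE jN.
Qed.

(** Stated for any morphism to a domain, so as to serve for slices, for the hyperbola and for
    evaluation at a matrix. *)
Definition D_ideal_eqs_at (B : idomainType) (f : {rmorphism R -> B}) : Prop :=
  let a' := f a%:MP in let b' := f b%:MP in
  [/\ a' * f x ^+ 2 + b' * (f y * f z) - a' ^+ 2 * f x = 0,
      f y * (a' * f x + b' * f w - a' * b') = 0,
      f z * (a' * f x + b' * f w - a' * b') = 0 &
      a' * (f y * f z) + b' * f w ^+ 2 - b' ^+ 2 * f w = 0].

Lemma D_ideal_ker (B : idomainType) (f : {rmorphism R -> B}) :
  D_ideal_eqs_at f -> {subset D_ideal A <= ker_ideal f}.
Proof.
move=> [e1 e2 e3 e4]; apply: gen_ideal_sub => -[k l] /=.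
rewrite D_equationsE mxE.
do 2 case: ifP => _;
rewrite ker_idealE !(rmorphB, rmorphD, rmorphM, rmorphXn) /=;
by rewrite ?e1 ?e2 ?e3 ?e4.
Qed.

End Equations.
End Variety.

(** * Exactly one zero eigenvalue *)

Section SliceEvaluation.
Variables (F : finFieldType) (j : 'I_2) (ox oy oz ow : option F).
Local Notation R := {mpoly F[4]}.
Local Notation j' := (rev_ord j).
Local Notation C := (mx_at j ox oy oz ow).

Definition slice_map : {rmorphism R -> _} :=
  frac_eval (den (slice (fun i : 'I_4 => mxvec C 0 (i : 'I_(2 * 2)))))
            (num (slice (fun i : 'I_4 => mxvec C 0 (i : 'I_(2 * 2))))).

Lemma slice_mapE c :
  [/\ ox = Some c -> slice_map (entry F j j) = slice_map c%:MP,
      oy = Some c -> slice_map (entry F j j') = slice_map c%:MP,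
      oz = Some c -> slice_map (entry F j' j) = slice_map c%:MP &
      ow = Some c -> slice_map (entry F j' j') = slice_map c%:MP].
Proof.
have [ex ey ez ew] := mem_mx_slice j ox oy oz ow c.
split=> oc; apply/eqP; rewrite -subr_eq0 -rmorphB.
- by apply: (etrans ex); rewrite oc eqxx.
- by apply: (etrans ey); rewrite oc eqxx.
- by apply: (etrans ez); rewrite oc eqxx.
- by apply: (etrans ew); rewrite oc eqxx.
Qed.

Definition coord_eq (B : idomainType) (f : {rmorphism R -> B}) (v : R) o :=
  forall c, o = Some c -> f v = f c%:MP.

(** Quantifying over all morphisms hides the fraction field and leaves a purely equational check for
    each slice. *)
Lemma D_ideal_slice (a b : F) :
  (forall (B : idomainType) (f : {rmorphism R -> B}),
     coord_eq f (entry F j j) ox -> coord_eq f (entry F j j') oy ->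
     coord_eq f (entry F j' j) oz -> coord_eq f (entry F j' j') ow ->
     D_ideal_eqs_at j a b f) ->
  {subset D_ideal (mx_at j a 0 0 b) <= mx_slice C}.
Proof.
move=> eqs; apply: (@D_ideal_ker F j a b _ slice_map).
by apply: eqs => c; have [] := slice_mapE c.
Qed.

End SliceEvaluation.

Section OneZero.
Variables (F : finFieldType) (j : 'I_2) (a : F).
Hypothesis a0 : a != 0.
Local Notation A := (mx_at j a 0 0 0).

Definition plane_yw := mx_slice (mx_at j (Some (0 : F)) None (Some 0) None).
Definition plane_zw := mx_slice (mx_at j (Some (0 : F)) (Some 0) None None).
Definition line_w := mx_slice (mx_at j (Some a) (Some 0) (Some 0) None).
Definition one_zero_components (k : 'I_3) :=
  nth plane_yw [:: plane_yw; plane_zw; line_w] k.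

Lemma one_zero_components_sup k : {subset D_ideal A <= one_zero_components k}.
Proof.
case: k => [[|[|[|k]]] hk] //; apply: D_ideal_slice.
- move=> B f /(_ 0 erefl) e1 _ /(_ 0 erefl) e3 _.
  by rewrite /D_ideal_eqs_at e1 e3 !mpolyC0 !rmorph0; split; ring.
- move=> B f /(_ 0 erefl) e1 /(_ 0 erefl) e2 _ _.
  by rewrite /D_ideal_eqs_at e1 e2 !mpolyC0 !rmorph0; split; ring.
- move=> B f /(_ a erefl) e1 /(_ 0 erefl) e2 /(_ 0 erefl) e3 _.
  by rewrite /D_ideal_eqs_at e1 e2 e3 !mpolyC0 !rmorph0; split; ring.
Qed.

(** For [b = 0] the equations are, up to powers of the unit [a], [x * (x - a)], [y * x], [z * x] and
    [y * z]. Either [x] lies in [P], and then [y] or [z] does, or [x - a], [y] and [z] all do. *)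
Lemma one_zero_components_cover (P : prime_idealr {mpoly F[4]}) :
  {subset D_ideal A <= P} -> exists k, {subset one_zero_components k <= P}.
Proof.
move=> /D_ideal_eqs[]; rewrite mpolyC0.
set x := entry F j j; set y := entry F j _; set z := entry F _ j.
set w := entry F _ _.
have aP : a%:MP \notin P by rewrite const_prime_idealr.
have ->: a%:MP * x ^+ 2 + 0 * (y * z) - a%:MP ^+ 2 * x
  = a%:MP * (x * (x - a%:MP)) by ring.
have ->: y * (a%:MP * x + 0 * w - a%:MP * 0) = a%:MP * (y * x) by ring.
have ->: z * (a%:MP * x + 0 * w - a%:MP * 0) = a%:MP * (z * x) by ring.
have ->: a%:MP * (y * z) + 0 * w ^+ 2 - 0 ^+ 2 * w = a%:MP * (y * z) by ring.
rewrite !prime_idealrM (negPf aP) /=.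
have [xP _ _ _|xP /= xaP] := boolP (x \in P).
  case/orP=> [yP|zP]; [exists (inord 1)|exists ord0];
  rewrite /one_zero_components ?inordK //=; apply: mx_slice_min;
  by rewrite /coord_in // mpolyC0 subr0.
rewrite !orbF => yP zP _; exists (inord 2).
rewrite /one_zero_components inordK //=.
by apply: mx_slice_min; rewrite /coord_in // mpolyC0 subr0.
Qed.

Lemma one_zero_components_inj k l :
  {subset one_zero_components k <= one_zero_components l} -> k = l.
Proof.
case: k l => [[|[|[|k]]] hk] [[|[|[|l]]] hl] //;
try (by move=> _; apply: val_inj);
by move/sub_mx_slice; rewrite /coord_le /= ?andbF // !(inj_eq Some_inj) eq_sym
  (negPf a0).
Qed.

Lemma one_zero_variety :
  variety_dim (D_ideal A) 2 /\
  exists P : 'I_3 -> prime_idealr {mpoly F[4]},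
    [/\ components (D_ideal A) P,
        forall k : 'I_3, (k < 2)%N -> variety_dim (P k) 2
      & forall k : 'I_3, (2 <= k)%N -> variety_dim (P k) 1].
Proof.
have [dim0 chain0 le0] := @mx_slice_dim F j (Some 0) None (Some 0) None _ erefl.
have [dim1 _ le1] := @mx_slice_dim F j (Some 0) (Some 0) None None _ erefl.
have [dim2 _ le2] := @mx_slice_dim F j (Some a) (Some 0) (Some 0) None _ erefl.
split.
  apply: variety_dim_above.
    (* A chain over one component is a chain over [D_ideal A]. *)
    have [P [chP leP]] := chain0; exists P; split=> // i x xD.
    by apply/leP/(@one_zero_components_sup ord0).
  apply: (chains_above_le_cover one_zero_components_cover) => -[[|[|[|k]]] hk].
  - exact: le0.
  - exact: le1.
  - by move=> n P chP leP; apply: leqW; apply: le2 P chP leP.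
  - case: (notF hk).
exists one_zero_components; split.
- exact: components_cover one_zero_components_sup
    one_zero_components_inj one_zero_components_cover.
- by case=> [[|[|k]] hk] lt;
    [exact: dim0 | exact: dim1 | case: (notF lt)].
- by case=> [[|[|[|k]]] hk] lt;
    [case: (notF lt) | case: (notF lt) | exact: dim2 | case: (notF hk)].
Qed.

End OneZero.

(** * Two nonzero eigenvalues *)

Section BothNonzero.
Variables (F : finFieldType) (j : 'I_2) (a b : F).
Hypotheses (a0 : a != 0) (b0 : b != 0) (ab : a != b).
Local Notation A := (mx_at j a 0 0 b).
Local Notation R := {mpoly F[4]}.
Local Notation x := (entry F j j).
Local Notation y := (entry F j (rev_ord j)).
Local Notation z := (entry F (rev_ord j) j).
Local Notation w := (entry F (rev_ord j) (rev_ord j)).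

Definition delta : F := a ^+ 2 - a * b + b ^+ 2.
Definition hyp_x : F := b ^+ 2 / (b - a).
Definition hyp_w : F := a ^+ 2 / (a - b).
Definition hyp_yz : F := - (a * b * delta) / (a - b) ^+ 2.

Lemma sub_ab0 : a - b != 0. Proof. by rewrite subr_eq0. Qed.
Lemma sub_ba0 : b - a != 0. Proof. by rewrite subr_eq0 eq_sym. Qed.

Lemma hyp_line : a * hyp_x + b * hyp_w = a * b.
Proof.
rewrite /hyp_x /hyp_w; field; rewrite sub_ab0 sub_ba0 //.
Qed.

Lemma hyp_entry11 : a * hyp_x ^+ 2 + b * hyp_yz - a ^+ 2 * hyp_x = 0.
Proof. rewrite /hyp_x /hyp_yz /delta; field; by rewrite sub_ab0 sub_ba0. Qed.

Lemma hyp_entry22 : a * hyp_yz + b * hyp_w ^+ 2 - b ^+ 2 * hyp_w = 0.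
Proof. rewrite /hyp_w /hyp_yz /delta; field; by rewrite sub_ab0. Qed.

Definition pt00 := mx_slice (mx_at j (Some (0 : F)) (Some 0) (Some 0) (Some 0)).
Definition pt10 := mx_slice (mx_at j (Some a) (Some 0) (Some 0) (Some 0)).
Definition pt01 := mx_slice (mx_at j (Some (0 : F)) (Some 0) (Some 0) (Some b)).
Definition pt11 := mx_slice (mx_at j (Some a) (Some 0) (Some 0) (Some b)).

Lemma D_ideal_primes (P : prime_idealr R) : {subset D_ideal A <= P} ->
  [/\ y \in P, z \in P, (x \in P) || (x - a%:MP \in P)
    & (w \in P) || (w - b%:MP \in P)] \/
  [/\ x - hyp_x%:MP \in P, w - hyp_w%:MP \in P & y * z - hyp_yz%:MP \in P].
Proof.
have constP c : c != 0 -> (c%:MP \in P) = false.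
  by move=> c0; rewrite const_prime_idealr (negPf c0).
have cancelP c v : c != 0 -> c%:MP * v \in P -> v \in P.
  by move=> c0; rewrite prime_idealrM constP.
move=> /D_ideal_eqs[]; set L := _ + _ - a%:MP * b%:MP => E1P E2P E3P E4P.
have [LP|LP] := boolP (L \in P); [right|left]; last first.
  have yP : y \in P by move: E2P; rewrite prime_idealrM (negPf LP) orbF.
  have zP : z \in P by move: E3P; rewrite prime_idealrM (negPf LP) orbF.
  split=> //; rewrite -prime_idealrM.
    apply: (cancelP a) => //.
    have -> : a%:MP * (x * (x - a%:MP)) =
      (a%:MP * x ^+ 2 + b%:MP * (y * z) - a%:MP ^+ 2 * x)
      - b%:MP * z * y by ring.
    by rewrite rpredB ?idealMr.
  apply: (cancelP b) => //.
  have -> : b%:MP * (w * (w - b%:MP)) =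
    (a%:MP * (y * z) + b%:MP * w ^+ 2 - b%:MP ^+ 2 * w) - a%:MP * z * y by ring.
  by rewrite rpredB ?idealMr.
have xP : x - hyp_x%:MP \in P.
  apply: (cancelP (a * (b - a) ^+ 2)).
    by rewrite mulf_neq0 ?expf_neq0 ?sub_ba0.
  have -> : (a * (b - a) ^+ 2)%:MP * (x - hyp_x%:MP) =
      (a * (b - a))%:MP * ((b - a)%:MP * x - (b ^+ 2)%:MP).
    rewrite -[b ^+ 2](divfK sub_ba0) -/hyp_x; ring.
  (* [b] times the last equation minus [a] times the first eliminates [y * z]. Replacing [b * w] by
     [a * b - a * x] modulo [L] then cancels the quadratic terms and leaves a linear equation in
     [x]. *)
  have -> : (a * (b - a))%:MP * ((b - a)%:MP * x - (b ^+ 2)%:MP) =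
      b%:MP * (a%:MP * (y * z) + b%:MP * w ^+ 2 - b%:MP ^+ 2 * w)
      - a%:MP * (a%:MP * x ^+ 2 + b%:MP * (y * z) - a%:MP ^+ 2 * x)
      + (b%:MP ^+ 2 - b%:MP * w - a%:MP * b%:MP + a%:MP * x) * L.
    by rewrite /L; ring.
  by rewrite rpredD ?rpredB ?idealMr.
split=> //.
  apply: (cancelP b) => //.
  have -> : b%:MP * (w - hyp_w%:MP) = L - a%:MP * (x - hyp_x%:MP).
    have := congr1 (@mpolyC 4 F) hyp_line.
    rewrite /L !rmorphD !rmorphM /= => <-.
    by ring.
  by rewrite rpredB ?idealMr.
apply: (cancelP b) => //.
(* The values of [a x^2 - a^2 x] at [x] and at [hyp_x] differ by a multiple of [x - hyp_x];
   [hyp_entry11] accounts for the constant. *)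
have -> : b%:MP * (y * z - hyp_yz%:MP) =
    (a%:MP * x ^+ 2 + b%:MP * (y * z) - a%:MP ^+ 2 * x)
    - a%:MP * (x + hyp_x%:MP - a%:MP) * (x - hyp_x%:MP).
  have := congr1 (@mpolyC 4 F) hyp_entry11.
  rewrite mpolyC0 => e.
  by rewrite -[LHS]addr0 -[in LHS]e; ring.
by rewrite rpredB ?idealMr.
Qed.

(** * Case delta = 0: two crossing lines *)

Section DegenerateHyperbola.
Hypothesis delta0 : delta = 0.

Definition line_y := mx_slice (mx_at j (Some a) None (Some 0) (Some b)).
Definition line_z := mx_slice (mx_at j (Some a) (Some 0) None (Some b)).
(** [pt11] is absent: it is the point where [line_y] and [line_z] cross. *)
Definition degenerate_components (k : 'I_5) :=
  nth pt00 [:: pt00; pt10; pt01; line_y; line_z] k.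

(** If [delta] vanishes then [b ^+ 2 = a * (b - a)]. *)
Lemma hyp_x_deg : hyp_x = a.
Proof.
apply/eqP; rewrite -subr_eq0 -[_ == 0](mulIr_eq0 _ (mulIf sub_ba0)).
by rewrite mulrBl divfK ?sub_ba0 // -[0]delta0 /delta; apply/eqP; ring.
Qed.

Lemma hyp_w_deg : hyp_w = b.
Proof.
apply/eqP; rewrite -subr_eq0 -[_ == 0](mulIr_eq0 _ (mulIf sub_ab0)).
by rewrite mulrBl divfK ?sub_ab0 // -[0]delta0 /delta; apply/eqP; ring.
Qed.

Lemma hyp_yz_deg : hyp_yz = 0.
Proof. by rewrite /hyp_yz delta0 mulr0 oppr0 mul0r. Qed.

Lemma degenerate_components_sup k :
  {subset D_ideal A <= degenerate_components k}.
Proof.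
have fdelta (B : idomainType) (f : {rmorphism R -> B}) :
    f a%:MP * f a%:MP + f b%:MP * f b%:MP - f a%:MP * f b%:MP = 0.
  rewrite -!rmorphM -rmorphD -rmorphB /= -(rmorph0 f) -mpolyC0 -delta0 /delta.
  by congr (f _); ring.
case: k => [[|[|[|[|[|k]]]]] hk]; [| | | | |case: (notF hk)];
apply: D_ideal_slice.
- move=> B f /(_ 0 erefl) e1 /(_ 0 erefl) e2 /(_ 0 erefl) e3 /(_ 0 erefl) e4.
  by rewrite /D_ideal_eqs_at e1 e2 e3 e4 !mpolyC0 !rmorph0; split; ring.
- move=> B f /(_ a erefl) e1 /(_ 0 erefl) e2 /(_ 0 erefl) e3 /(_ 0 erefl) e4.
  by rewrite /D_ideal_eqs_at e1 e2 e3 e4 !mpolyC0 !rmorph0; split; ring.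
- move=> B f /(_ 0 erefl) e1 /(_ 0 erefl) e2 /(_ 0 erefl) e3 /(_ b erefl) e4.
  by rewrite /D_ideal_eqs_at e1 e2 e3 e4 !mpolyC0 !rmorph0; split; ring.
- move=> B f /(_ a erefl) e1 _ /(_ 0 erefl) e3 /(_ b erefl) e4.
  by rewrite /D_ideal_eqs_at e1 e3 e4 !mpolyC0 !rmorph0 fdelta; split; ring.
- move=> B f /(_ a erefl) e1 /(_ 0 erefl) e2 _ /(_ b erefl) e4.
  by rewrite /D_ideal_eqs_at e1 e2 e4 !mpolyC0 !rmorph0 fdelta; split; ring.
Qed.

Lemma degenerate_components_cover (P : prime_idealr R) :
  {subset D_ideal A <= P} -> exists k, {subset degenerate_components k <= P}.
Proof.
case/D_ideal_primes; last first.
  rewrite hyp_x_deg hyp_w_deg hyp_yz_deg mpolyC0 subr0 prime_idealrM.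
  move=> [xP wP /orP[yP|zP]]; [exists (inord 4)|exists (inord 3)];
  rewrite /degenerate_components inordK //=; apply: mx_slice_min;
  by rewrite /coord_in // ?mpolyC0 ?subr0.
move=> [yP zP /orP[]xP /orP[]wP];
  [exists (inord 0)|exists (inord 2)|exists (inord 1)|exists (inord 3)];
rewrite /degenerate_components inordK //=; apply: mx_slice_min;
  by rewrite /coord_in // ?mpolyC0 ?subr0.
Qed.

Lemma degenerate_components_inj k l :
  {subset degenerate_components k <= degenerate_components l} -> k = l.
Proof.
case: k l => [[|[|[|[|[|k]]]]] hk] [[|[|[|[|[|l]]]]] hl];
try (by case: (notF hk)); try (by case: (notF hl));
try (by move=> _; apply: val_inj);
by move/sub_mx_slice;
  rewrite /coord_le /= ?andbF // !(inj_eq Some_inj) ?eqxx ?[0 == a]eq_sym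
    ?[0 == b]eq_sym ?(negPf a0) ?(negPf b0) ?andbF.
Qed.

Lemma degenerate_variety :
  variety_dim (D_ideal A) 1 /\
  exists P : 'I_5 -> prime_idealr R,
    [/\ components (D_ideal A) P,
        forall k : 'I_5, (k < 3)%N -> is_point (P k)
      & forall k : 'I_5, (3 <= k)%N -> variety_dim (P k) 1].
Proof.
have [_ _ le0] := @mx_slice_dim F j (Some 0) (Some 0) (Some 0) (Some 0) _ erefl.
have [_ _ le1] := @mx_slice_dim F j (Some a) (Some 0) (Some 0) (Some 0) _ erefl.
have [_ _ le2] := @mx_slice_dim F j (Some 0) (Some 0) (Some 0) (Some b) _ erefl.
have [dim3 chain3 le3] :=
  @mx_slice_dim F j (Some a) None (Some 0) (Some b) _ erefl.
have [dim4 _ le4] := @mx_slice_dim F j (Some a) (Some 0) None (Some b) _ erefl.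
split.
  apply: variety_dim_above.
    have [P [chP leP]] := chain3; exists P; split=> // i v vD.
    by apply/leP/(@degenerate_components_sup (@Ordinal 5 3 isT)).
  apply: (chains_above_le_cover degenerate_components_cover).
  case=> [[|[|[|[|[|k]]]]] hk].
  - by move=> n P chP leP; apply: leqW; apply: le0 P chP leP.
  - by move=> n P chP leP; apply: leqW; apply: le1 P chP leP.
  - by move=> n P chP leP; apply: leqW; apply: le2 P chP leP.
  - exact: le3.
  - exact: le4.
  - case: (notF hk).
exists degenerate_components; split.
- exact: components_cover degenerate_components_sup
    degenerate_components_inj degenerate_components_cover.
- by case=> [[|[|[|k]]] hk] lt; [exact: point_idealP.. | case: (notF lt)].
- by case=> [[|[|[|[|[|k]]]]] hk] lt;
    [case: (notF lt) | case: (notF lt) | case: (notF lt) |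
     exact: dim3 | exact: dim4 | case: (notF hk)].
Qed.

End DegenerateHyperbola.

(** * Case delta nonzero: the hyperbola *)

Section Hyperbola.
Hypothesis delta_neq0 : delta != 0.
Local Notation S := {mpoly F[1]}.
Local Notation X := ('X_ord0 : S).

Lemma hyp_yz_neq0 : hyp_yz != 0.
Proof.
rewrite /hyp_yz mulf_neq0 ?invr_neq0 ?expf_neq0 ?sub_ab0 //.
by rewrite oppr_eq0 !mulf_neq0.
Qed.

(** The parametrization sends [t] to [x = hyp_x], [y = t], [z = hyp_yz / t], [w = hyp_w], here
    written over the common denominator [t]; hence [X * X] for [y]. *)
Definition hyp_num (i : 'I_4) : S :=
  mxvec (mx_at j (hyp_x%:MP * X) (X * X) hyp_yz%:MP (hyp_w%:MP * X)) 0
        (i : 'I_(2 * 2)).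

Lemma hyp_den_neq0 : X != 0.
Proof.
apply/eqP => /(congr1 (mcoeff U_(ord0))); rewrite mcoeffX mcoeff0 eqxx.
by move/eqP; rewrite oner_eq0.
Qed.

Lemma tofrac_den_neq0 : tofrac X != 0.
Proof. by rewrite tofrac_eq0 hyp_den_neq0. Qed.

Local Notation phi := (frac_eval X hyp_num).

Lemma hyp_eval :
  [/\ phi x = tofrac hyp_x%:MP, phi y = tofrac X,
      phi z = tofrac hyp_yz%:MP / tofrac X & phi w = tofrac hyp_w%:MP].
Proof.
have jN := rev_ord2_neq j.
have X0 := tofrac_den_neq0.
by split; rewrite /frac_eval mmapX mmap1U /hyp_num mxvecE mxE ?eqxx ?jN //
  tofracM mulfK.
Qed.

Lemma hyp_secK (i : 'I_1) : phi y = tofrac 'X_i.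
Proof.
have -> : i = ord0 by rewrite [i]ord1; apply: val_inj.
by have [] := hyp_eval.
Qed.

(** On the hyperbola [1 / y] is the polynomial [z / hyp_yz]; this is where [delta] must be
    nonzero. *)
Lemma hyp_den_invK : phi (hyp_yz^-1%:MP * z) = (tofrac X)^-1.
Proof.
have [_ _ ez _] := hyp_eval.
rewrite rmorphM /= ez /frac_eval mmapC /= mulrA -tofracM -mpolyCM.
by rewrite mulVf ?hyp_yz_neq0 // mpolyC1 tofrac1 mul1r.
Qed.

Definition hyperbola : parametrization F 4 1 :=
  Parametrization hyp_den_neq0 hyp_secK hyp_den_invK.

Lemma hyperbola_satisfied (I : idealr R) :
  x - hyp_x%:MP \in I -> w - hyp_w%:MP \in I -> y * z - hyp_yz%:MP \in I ->
  satisfied hyperbola I.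
Proof.
move=> xI wI yzI.
have psiX : poly_eval (sec hyperbola) X = y by rewrite /poly_eval mmapX mmap1U.
have psiC c : poly_eval (sec hyperbola) c%:MP = c%:MP.
  by rewrite /poly_eval mmapC.
have psiM u v : poly_eval (sec hyperbola) (u * v) =
    poly_eval (sec hyperbola) u * poly_eval (sec hyperbola) v by exact: rmorphM.
split=> [i|]; rewrite /= psiX.
  case: i / (@mxvec_indexP 2 2 i) => k l.
  rewrite /hyp_num mxvecE -/(entry F k l).
  have /matrixP/(_ k l) := generic_mxE F j; rewrite !mxE -/(entry F k l) => ->.
  do 2 case: ifP => _; rewrite 1?psiM ?psiX ?psiC.
  - by rewrite [hyp_x%:MP * _]mulrC -mulrBr idealMr.
  - by rewrite subrr idealr0.
  - exact: yzI.
  - by rewrite [hyp_w%:MP * _]mulrC -mulrBr idealMr.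
have -> : y * (hyp_yz^-1%:MP * z) - 1 = hyp_yz^-1%:MP * (y * z - hyp_yz%:MP).
  by rewrite mulrBr -mpolyCM mulVf ?hyp_yz_neq0 // mpolyC1 mulrCA.
exact: idealMr.
Qed.

Definition hyperbola_components (k : 'I_5) :=
  nth pt00 [:: pt00; pt10; pt01; pt11; param_ideal hyperbola] k.

Lemma hyperbola_sup : {subset D_ideal A <= param_ideal hyperbola}.
Proof.
have phiC c : phi c%:MP = tofrac c%:MP by rewrite /frac_eval mmapC.
have [ex ey ez ew] := hyp_eval; apply: D_ideal_ker.
rewrite /D_ideal_eqs_at /=.
have -> : phi y * phi z = phi hyp_yz%:MP.
  by rewrite ey ez phiC mulrC divfK ?tofrac_den_neq0.
rewrite ex ew -!phiC.
have e11 : phi (a * hyp_x ^+ 2 + b * hyp_yz - a ^+ 2 * hyp_x)%:MP = 0.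
  by rewrite hyp_entry11 mpolyC0 rmorph0.
have e12 : phi (a * hyp_x + b * hyp_w - a * b)%:MP = 0.
  by rewrite hyp_line subrr mpolyC0 rmorph0.
have e22 : phi (a * hyp_yz + b * hyp_w ^+ 2 - b ^+ 2 * hyp_w)%:MP = 0.
  by rewrite hyp_entry22 mpolyC0 rmorph0.
split.
- by rewrite -[RHS]e11; ring.
- by rewrite -[RHS](mulr0 (phi y)) -e12; ring.
- by rewrite -[RHS](mulr0 (phi z)) -e12; ring.
- by rewrite -[RHS]e22; ring.
Qed.

Lemma mem_hyperbola :
  [/\ x - hyp_x%:MP \in param_ideal hyperbola,
      w - hyp_w%:MP \in param_ideal hyperbola,
      y * z - hyp_yz%:MP \in param_ideal hyperbola &
      forall c, y - c%:MP \notin param_ideal hyperbola].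
Proof.
have phiC c : phi c%:MP = tofrac c%:MP by rewrite /frac_eval mmapC.
have [ex ey ez ew] := hyp_eval.
have phiM u v : phi (u * v) = phi u * phi v by exact: rmorphM.
split; rewrite ?ker_idealE ?rmorphB /=.
- by rewrite ex phiC subrr.
- by rewrite ew phiC subrr.
- by rewrite phiM ey ez phiC [_ * (_ / _)]mulrC divfK ?tofrac_den_neq0 // subrr.
move=> c; rewrite ker_idealE rmorphB /= ey phiC -tofracB tofrac_eq0 subr_eq0.
apply/eqP => /(congr1 (mcoeff U_(ord0))); rewrite mcoeffX mcoeffC eqxx mnm1_eq0.
by rewrite mulr0 => /eqP; rewrite oner_eq0.
Qed.

Lemma hyperbola_components_sup k : {subset D_ideal A <= hyperbola_components k}.
Proof.
case: k => [[|[|[|[|[|k]]]]] hk]; [| | | |exact: hyperbola_sup|case: (notF hk)];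
apply: D_ideal_slice.
- move=> B f /(_ 0 erefl) e1 /(_ 0 erefl) e2 /(_ 0 erefl) e3 /(_ 0 erefl) e4.
  by rewrite /D_ideal_eqs_at e1 e2 e3 e4 !mpolyC0 !rmorph0; split; ring.
- move=> B f /(_ a erefl) e1 /(_ 0 erefl) e2 /(_ 0 erefl) e3 /(_ 0 erefl) e4.
  by rewrite /D_ideal_eqs_at e1 e2 e3 e4 !mpolyC0 !rmorph0; split; ring.
- move=> B f /(_ 0 erefl) e1 /(_ 0 erefl) e2 /(_ 0 erefl) e3 /(_ b erefl) e4.
  by rewrite /D_ideal_eqs_at e1 e2 e3 e4 !mpolyC0 !rmorph0; split; ring.
- move=> B f /(_ a erefl) e1 /(_ 0 erefl) e2 /(_ 0 erefl) e3 /(_ b erefl) e4.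
  by rewrite /D_ideal_eqs_at e1 e2 e3 e4 !mpolyC0 !rmorph0; split; ring.
Qed.

Lemma hyperbola_components_cover (P : prime_idealr R) :
  {subset D_ideal A <= P} -> exists k, {subset hyperbola_components k <= P}.
Proof.
case/D_ideal_primes; last first.
  move=> [xP wP yzP]; exists (inord 4).
  rewrite /hyperbola_components inordK //=.
  by apply: (param_ideal_min (p := hyperbola)); apply: hyperbola_satisfied.
move=> [yP zP /orP[]xP /orP[]wP];
  [exists (inord 0)|exists (inord 2)|exists (inord 1)|exists (inord 3)];
rewrite /hyperbola_components inordK //=; apply: mx_slice_min;
  by rewrite /coord_in // ?mpolyC0 ?subr0.
Qed.

Lemma slice_not_sub_hyperbola ox oz ow c :
  ~ {subset mx_slice (mx_at j ox (Some c) oz ow) <= param_ideal hyperbola}.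
Proof.
have [_ _ _ /(_ c)/negP yN] := mem_hyperbola; move=> sub; apply/yN/sub.
by have [_ -> _ _] := mem_mx_slice j ox (Some c) oz ow c.
Qed.

(** With [y = 0], the relation [y * z = hyp_yz] would put a nonzero constant into a prime. *)
Lemma hyperbola_not_sub_slice ox oz ow :
  ~ {subset param_ideal hyperbola <= mx_slice (mx_at j ox (Some 0) oz ow)}.
Proof.
have [_ _ yz _] := mem_hyperbola; move=> /(_ _ yz).
have [_ + _ _] := mem_mx_slice j ox (Some 0) oz ow 0.
rewrite mpolyC0 subr0 eqxx => yP.
rewrite rpredBl; last by rewrite mulrC idealMr.
by rewrite const_prime_idealr (negPf hyp_yz_neq0).
Qed.

Lemma hyperbola_components_inj k l :
  {subset hyperbola_components k <= hyperbola_components l} -> k = l.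
Proof.
case: k l => [[|[|[|[|[|k]]]]] hk] [[|[|[|[|[|l]]]]] hl];
try (by case: (notF hk)); try (by case: (notF hl));
try (by move=> _; apply: val_inj).
(* Twenty off-diagonal pairs remain, row by row. The fourth of each of the first four rows has the
   hyperbola on the right; once these are closed, the last four have it on the left. *)
4,8,12,16: by move/slice_not_sub_hyperbola.
13-16: by move/hyperbola_not_sub_slice.
all: by move/sub_mx_slice;
  rewrite /coord_le /= ?andbF // !(inj_eq Some_inj) ?eqxx ?[0 == a]eq_sym
    ?[0 == b]eq_sym ?(negPf a0) ?(negPf b0) ?andbF.
Qed.

Lemma hyperbola_dim :
  [/\ variety_dim (param_ideal hyperbola) 1,
      chain_above (param_ideal hyperbola) 1
    & chains_above_le (param_ideal hyperbola) 1].
Proof.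
have le1 := param_chains_le (p := hyperbola).
suff ch1 : chain_above (param_ideal hyperbola) 1.
  by split=> //; apply: variety_dim_above.
(* The point of the hyperbola with [y = 1] tops a chain of length one. *)
pose P := mx_slice (mx_at j (Some hyp_x) (Some 1) (Some hyp_yz) (Some hyp_w)).
have mem c := mem_mx_slice j (Some hyp_x) (Some 1) (Some hyp_yz) (Some hyp_w) c.
have [_ + _ _] := mem 1; rewrite eqxx => yP.
apply: (chain_aboveS (p := param_ideal hyperbola) (p' := P) (x := y - 1%:MP)).
- by move=> v.
- apply: (param_ideal_min (p := hyperbola)); apply: hyperbola_satisfied.
  + by have [-> _ _ _] := mem hyp_x.
  + by have [_ _ _ ->] := mem hyp_w.
  + have [_ _ + _] := mem hyp_yz; rewrite eqxx => zP.
    have -> : y * z - hyp_yz%:MP = z * (y - 1%:MP) + (z - hyp_yz%:MP).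
      by rewrite mpolyC1; ring.
    apply: rpredD; last exact: zP.
    by apply: idealMr; exact: yP.
- exact: yP.
- by have [_ _ _] := mem_hyperbola; apply.
- exact: (chain_above0 (p := P)).
Qed.

Lemma hyperbola_variety :
  variety_dim (D_ideal A) 1 /\
  exists P : 'I_5 -> prime_idealr R,
    [/\ components (D_ideal A) P,
        forall k : 'I_5, (k < 4)%N -> is_point (P k)
      & forall k : 'I_5, (4 <= k)%N -> variety_dim (P k) 1].
Proof.
have [_ _ le0] := @mx_slice_dim F j (Some 0) (Some 0) (Some 0) (Some 0) _ erefl.
have [_ _ le1] := @mx_slice_dim F j (Some a) (Some 0) (Some 0) (Some 0) _ erefl.
have [_ _ le2] := @mx_slice_dim F j (Some 0) (Some 0) (Some 0) (Some b) _ erefl.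
have [_ _ le3] := @mx_slice_dim F j (Some a) (Some 0) (Some 0) (Some b) _ erefl.
have [dim4 chain4 le4] := hyperbola_dim.
split.
  apply: variety_dim_above.
    have [P [chP leP]] := chain4; exists P; split=> // i v vD.
    by apply/leP/hyperbola_sup.
  apply: (chains_above_le_cover hyperbola_components_cover).
  case=> [[|[|[|[|[|k]]]]] hk].
  - by move=> n P chP leP; apply: leqW; apply: le0 P chP leP.
  - by move=> n P chP leP; apply: leqW; apply: le1 P chP leP.
  - by move=> n P chP leP; apply: leqW; apply: le2 P chP leP.
  - by move=> n P chP leP; apply: leqW; apply: le3 P chP leP.
  - exact: le4.
  - case: (notF hk).
exists hyperbola_components; split.
- exact: components_cover hyperbola_components_sup
    hyperbola_components_inj hyperbola_components_cover.
- by case=> [[|[|[|[|k]]]] hk] lt; [exact: point_idealP.. | case: (notF lt)].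
- by case=> [[|[|[|[|[|k]]]]] hk] lt;
    [case: (notF lt) | case: (notF lt) | case: (notF lt) | case: (notF lt) |
     exact: dim4 | case: (notF hk)].
Qed.

End Hyperbola.
End BothNonzero.

(** * Counting points *)

Section Count.
Variables (F : finFieldType) (j : 'I_2) (a b : F).
Local Notation A := (mx_at j a 0 0 b).

Lemma mem_D_points x y z w : (mx_at j x y z w \in D_points A) =
  [&& a * x ^+ 2 + b * (y * z) - a ^+ 2 * x == 0,
      y * (a * x + b * w - a * b) == 0,
      z * (a * x + b * w - a * b) == 0 &
      a * (y * z) + b * w ^+ 2 - b ^+ 2 * w == 0].
Proof.
rewrite inE -subr_eq0 mx_at_equation.
have -> : 0 = mx_at j 0 0 0 0 :> 'M[F]_2.
  by apply/matrixP => k l; rewrite !mxE; do 2 case: eqP.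
by apply/eqP/and4P => [/mx_atP[-> -> -> ->]//|[/eqP-> /eqP-> /eqP-> /eqP->]].
Qed.

End Count.

Lemma card_setU_disjoint (T : finType) (A B : {set T}) :
  (forall u, u \in A -> u \notin B) -> #|A :|: B| = (#|A| + #|B|)%N.
Proof.
move=> AB; rewrite cardsU (_ : A :&: B = set0) ?cards0 ?subn0 //.
by apply/setP => u; rewrite !inE; apply/negP => /andP[/AB/negP].
Qed.

Lemma card_one_zero (F : finFieldType) j (a : F) : a != 0 ->
  #|D_points (mx_at j a 0 0 0)| = (2 * #|F| ^ 2)%N.
Proof.
move=> a0.
(* Two planes and a line, with [y = 0] removed from the second plane to make them disjoint:
   [q^2 + (q - 1) q + q = 2 q^2]. *)
pose P1 := [set mx_at j 0 0 v.1 v.2 | v in [set: F * F]].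
pose P2 := [set mx_at j 0 v.1 0 v.2 | v in setX [set~ 0] [set: F]].
pose P3 := [set mx_at j a 0 0 v | v in [set: F]].
have -> : D_points (mx_at j a 0 0 0) = P3 :|: (P1 :|: P2).
  apply/setP => M; rewrite (mx_at_eta j M).
  move: (M j j) (M j (rev_ord j)) (M (rev_ord j) j) (M (rev_ord j) (rev_ord j)).
  move=> x y z w.
  rewrite mem_D_points !inE; apply/and4P/or3P.
    rewrite !(mul0r, addr0, mulr0, subr0, expr0n, add0r) /=.
    rewrite !mulf_eq0 (negPf a0) /=.
    have -> : a * x ^+ 2 - a ^+ 2 * x = a * (x * (x - a)) by ring.
    rewrite !mulf_eq0 (negPf a0) /= subr_eq0.
    have [->|x0] := eqVneq x 0; case.
      move=> _ _ _; have [-> _|y0 /= /eqP->] := eqVneq y 0.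
        by apply: Or32; apply/imsetP; exists (z, w).
      by apply: Or33; apply/imsetP; exists (y, w); rewrite ?inE ?y0.
    rewrite /= !orbF => /eqP-> /eqP-> /eqP-> _.
    by apply: Or31; apply/imsetP; exists w.
  by case=> /imsetP[v _ /mx_atP[-> -> -> ->]]; split; apply/eqP; ring.
rewrite !card_setU_disjoint.
- rewrite !card_imset; first last.
  + by move=> u v /mx_atP[].
  + by move=> [u v] [u' v'] /mx_atP[_ _ /= -> ->].
  + by move=> [u v] [u' v'] /mx_atP[_ /= -> _ ->].
  rewrite cardsX cardsC1 !cardsT card_prod.
  have : (0 < #|F|)%N by apply/card_gt0P; exists 0.
  by case: #|F| => // n _; rewrite /=; lia.
- move=> M /imsetP[v _ ->]; apply/negP => /imsetP[u + /mx_atP[_ u0 _ _]].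
  by rewrite !inE -u0 eqxx.
- move=> M /imsetP[v _ ->]; rewrite inE; apply/negP.
  by case/orP=> /imsetP[u _ /mx_atP[e]]; move: a0; rewrite e eqxx.
Qed.

Section BothNonzeroCount.
Variables (F : finFieldType) (j : 'I_2) (a b : F).
Hypotheses (a0 : a != 0) (b0 : b != 0) (ab : a != b).
Local Notation A := (mx_at j a 0 0 b).

(** The kernel of evaluation at a solution is a prime over [D_ideal A], so [D_ideal_primes] also
    classifies the points. *)
Lemma D_pointsP x y z w : reflect
  ([/\ y = 0, z = 0, x \in [:: 0; a] & w \in [:: 0; b]] \/
   [/\ x = hyp_x a b, w = hyp_w a b & y * z = hyp_yz a b])
  (mx_at j x y z w \in D_points A).
Proof.
rewrite mem_D_points; apply: (iffP and4P); last first.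
  case=> [[-> ->]|[-> -> yz]].
    rewrite !inE => /orP[]/eqP-> /orP[]/eqP->; split; apply/eqP; ring.
  by rewrite yz hyp_entry11 // hyp_entry22 // hyp_line // subrr !mulr0 !eqxx.
case=> /eqP e1 /eqP e2 /eqP e3 /eqP e4.
pose v (i : 'I_4) := mxvec (mx_at j x y z w) 0 (i : 'I_(2 * 2)).
have jN := rev_ord2_neq j.
have fE k l : meval v (entry F k l) = mx_at j x y z w k l.
  by rewrite /entry mevalXU /v mxvecE.
have fx : meval v (entry F j j) = x by rewrite fE mxE eqxx.
have fy : meval v (entry F j (rev_ord j)) = y by rewrite fE mxE eqxx jN.
have fz : meval v (entry F (rev_ord j) j) = z by rewrite fE mxE eqxx jN.
have fw : meval v (entry F (rev_ord j) (rev_ord j)) = w by rewrite fE mxE jN.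
have /(D_ideal_primes a0 b0 ab) :
    {subset D_ideal A <= ker_ideal (meval v : {rmorphism {mpoly F[4]} -> F})}.
  by apply: D_ideal_ker; rewrite /D_ideal_eqs_at /= fx fy fz fw !mevalC.
rewrite !ker_idealE /= !mevalB mevalM !mevalC fx fy fz fw !subr_eq0.
case=> [[/eqP-> /eqP-> ex ew]|[/eqP-> /eqP-> /eqP->]]; last by right.
by left; rewrite !inE.
Qed.

Let diagonal_points :=
  [set mx_at j v.1 0 0 v.2 | v in setX [set 0; a] [set 0; b]].

Lemma card_diagonal_points : #|diagonal_points| = 4.
Proof.
rewrite card_imset ?cardsX ?cards2 1?[0 == a]eq_sym 1?[0 == b]eq_sym.
  by rewrite (negPf a0) (negPf b0).
by move=> [u v] [u' v'] /mx_atP[/= -> _ _ ->].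
Qed.

Lemma mem_diagonal_points x y z w : (mx_at j x y z w \in diagonal_points) =
  [&& y == 0, z == 0, x \in [:: 0; a] & w \in [:: 0; b]].
Proof.
apply/imsetP/and4P => [[[u v] + /mx_atP[-> -> -> ->]]|[/eqP-> /eqP-> xa wb]].
  by rewrite !inE /= => /andP[-> ->].
by exists (x, w) => //; rewrite !inE in xa wb *; rewrite xa wb.
Qed.

Lemma card_hyperbola : delta a b != 0 -> #|D_points A| = (#|F| + 3)%N.
Proof.
move=> d0; have k0 := hyp_yz_neq0 a0 b0 ab d0.
(* The hyperbola is parametrized by its nonzero [y], so it avoids the four diagonal points:
   [4 + (q - 1) = q + 3]. *)
pose P :=
  [set mx_at j (hyp_x a b) v (hyp_yz a b / v) (hyp_w a b) | v in [set~ 0]].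
have -> : D_points A = diagonal_points :|: P.
  apply/setP => M; rewrite (mx_at_eta j M).
  move: (M j j) (M j (rev_ord j)) (M (rev_ord j) j) (M (rev_ord j) (rev_ord j)).
  move=> x y z w; rewrite in_setU mem_diagonal_points.
  apply/D_pointsP/orP => [[]|[]].
  - by case=> -> -> xa wb; left; rewrite !eqxx xa.
  - case=> -> -> yz; right.
    have y0 : y != 0 by apply: contraNneq k0 => y0; rewrite -yz y0 mul0r.
    by apply/imsetP; exists y; rewrite ?inE // -yz mulrC mulKf.
  - by case/and4P=> /eqP-> /eqP-> xa wb; left.
  - move=> /imsetP[v + /mx_atP[-> -> -> ->]]; rewrite !inE => v0.
    by right; split=> //; rewrite mulrC divfK.
rewrite card_setU_disjoint.
  rewrite card_diagonal_points card_imset => [|u v /mx_atP[]//].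
  have : (0 < #|F|)%N by apply/card_gt0P; exists 0.
  by rewrite !cardsC1; case: #|F| => // n _; rewrite /=; lia.
move=> M /imsetP[u _ ->]; apply/negP => /imsetP[v + /mx_atP[_ v0 _ _]].
by rewrite !inE -v0 eqxx.
Qed.

Lemma card_degenerate : delta a b = 0 -> #|D_points A| = (2 * #|F| + 2)%N.
Proof.
move=> d0.
(* Both lines lose their crossing point, already counted among the diagonal points:
   [4 + 2 (q - 1) = 2 q + 2]. *)
pose Py := [set mx_at j a v 0 b | v in [set~ 0]].
pose Pz := [set mx_at j a 0 v b | v in [set~ 0]].
have -> : D_points A = diagonal_points :|: (Py :|: Pz).
  apply/setP => M; rewrite (mx_at_eta j M).
  move: (M j j) (M j (rev_ord j)) (M (rev_ord j) j) (M (rev_ord j) (rev_ord j)).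
  move=> x y z w; rewrite !in_setU mem_diagonal_points.
  apply/D_pointsP/or3P; rewrite hyp_x_deg // hyp_w_deg // hyp_yz_deg //.
    case=> [[-> -> xa wb]|[-> -> /eqP]]; first by apply: Or31; rewrite !eqxx xa.
    have [-> _|y0] := eqVneq y 0.
      have [->|z0] := eqVneq z 0.
        by apply: Or31; rewrite !inE !eqxx !orbT.
      by apply: Or33; apply/imsetP; exists z; rewrite ?inE.
    rewrite mulf_eq0 (negPf y0) => /eqP->.
    by apply: Or32; apply/imsetP; exists y; rewrite ?inE.
  case=> [/and4P[/eqP-> /eqP-> xa wb]|/imsetP[v _]|/imsetP[v _]].
  - by left.
  - by move=> /mx_atP[-> -> -> ->]; right; rewrite mulr0.
  - by move=> /mx_atP[-> -> -> ->]; right; rewrite mul0r.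
rewrite !card_setU_disjoint.
- rewrite card_diagonal_points.
  rewrite !card_imset => [|u v /mx_atP[]//|u v /mx_atP[]//].
  have : (0 < #|F|)%N by apply/card_gt0P; exists 0.
  by rewrite !cardsC1; case: #|F| => // n _; rewrite /=; lia.
- move=> M /imsetP[v + ->]; rewrite !inE => v0.
  apply/negP => /imsetP[u _ /mx_atP[_ e _ _]].
  by rewrite e eqxx in v0.
- move=> M /imsetP[u _ ->]; rewrite inE; apply/negP.
  by case/orP=> /imsetP[v + /mx_atP[_ e e' _]]; rewrite !inE -?e -?e' eqxx.
Qed.

End BothNonzeroCount.

Lemma diag2_at0 (F : finFieldType) (c1 c2 : F) :
  diag2 c1 c2 = mx_at ord0 c1 0 0 c2.
Proof. by apply/matrixP => -[[|[|]] // ?] [[|[|]] // ?]; rewrite !mxE. Qed.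

(** Reading the diagonal from its other end reduces [c1 = 0] to the case where the second entry
    vanishes. *)
Lemma diag2_at1 (F : finFieldType) (c1 c2 : F) :
  diag2 c1 c2 = mx_at ord_max c2 0 0 c1.
Proof. by apply/matrixP => -[[|[|]] // ?] [[|[|]] // ?]; rewrite !mxE. Qed.

Theorem theorem1p1 (F : finFieldType) (q : nat) (hq : #|F| = q)
    (c1 c2 : F) (hc : c1 <> c2) :
  let A1 := diag2 c1 c2 in
  let delta := c1 ^+ 2 - c1 * c2 + c2 ^+ 2 in
  ((c1 == 0) (+) (c2 == 0) ->
     [/\ variety_dim (D_ideal A1) 2,
         (exists P : 'I_3 -> prime_idealr {mpoly F[4]},
            [/\ components (D_ideal A1) P,
                forall k : 'I_3, (k < 2)%N -> variety_dim (P k) 2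
              & forall k : 'I_3, (2 <= k)%N -> variety_dim (P k) 1])
       & #|D_points A1| = (2 * q ^ 2)%N])
  /\
  (c1 <> 0 -> c2 <> 0 ->
     (delta = 0 ->
        [/\ #|D_points A1| = (2 * q + 2)%N,
            variety_dim (D_ideal A1) 1
          & exists P : 'I_5 -> prime_idealr {mpoly F[4]},
            [/\ components (D_ideal A1) P,
                forall k : 'I_5, (k < 3)%N -> is_point (P k)
              & forall k : 'I_5, (3 <= k)%N -> variety_dim (P k) 1]])
     /\
     (delta <> 0 ->
        [/\ #|D_points A1| = (q + 3)%N,
            variety_dim (D_ideal A1) 1
          & exists P : 'I_5 -> prime_idealr {mpoly F[4]},
            [/\ components (D_ideal A1) P,
                forall k : 'I_5, (k < 4)%N -> is_point (P k)
              & forall k : 'I_5, (4 <= k)%N -> variety_dim (P k) 1]])).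
Proof.
rewrite /= -hq; split=> [|/eqP c1_0 /eqP c2_0].
  have [c1_0 /= c2_0|c1_0 /= /eqP c2_0] := eqVneq c1 0.
    rewrite diag2_at1 c1_0.
    have [] := one_zero_variety ord_max c2_0; split=> //.
    exact: card_one_zero.
  rewrite diag2_at0 c2_0; have [] := one_zero_variety ord0 c1_0; split=> //.
  exact: card_one_zero.
have c12 : c1 != c2 by apply/eqP.
rewrite diag2_at0; split=> [d0|/eqP d0].
  have [] := degenerate_variety ord0 c1_0 c2_0 c12 d0; split=> //.
  exact: card_degenerate.
have [] := hyperbola_variety ord0 c1_0 c2_0 c12 d0; split=> //.
exact: card_hyperbola.
Qed.
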